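(* Let $\mathcal{F}_{nn}$ be the class of depth-$d$ neural networks with parameter set $\mathcal{W}_F$, whose activation functions satisfy Assumptions A and B of the context. Let $\mu,\nu\in\mathcal{P}_{uB}$ and let $\hat\mu_n,\hat\nu_m$ be the empirical measures of $\mu,\nu$. Let $\delta\in(0,1)$. If $\sqrt{6h}\,\min\{n,m\}\sqrt{m^{-1}+n^{-1}}\ge4\sqrt{\log(1/\delta)}$, then with probability at least $1-\delta$ over the randomness of $\hat\mu_n$ and $\hat\nu_m$, $$|d_{\mathcal{F}_{nn}}(\mu,\nu)-d_{\mathcal{F}_{nn}}(\hat\mu_n,\hat\nu_m)|\le2\mathcal{R}_n(\mathcal{F}_{nn},\mu)+2\mathcal{R}_m(\mathcal{F}_{nn},\nu)+2\Gamma_{uB}\prod_{i=1}^dM_F(i)\prod_{i=1}^{d-1}L_i\sqrt{2h\left(n^{-1}+m^{-1}\right)\log(1/\delta)}.$$ The same result holds when the parameter set is $\mathcal{W}_{1,\infty}$, with each $M_F(i)$ in the bound replaced by $M_{1,\infty}(i)$.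
   Context: Fix integers $h\ge1$ (input dimension), $d\ge2$ (depth), layer widths $k_1=h,k_2,\dots,k_d\ge1$, and sample sizes $n,m\ge1$. For a matrix $\mathbf{W}$, $\|\mathbf{W}\|_F$ is the Frobenius norm and $\|\mathbf{W}\|_{1,\infty}$ is the maximal $\ell_1$ norm of its rows; $\|\cdot\|$ on vectors is the $\ell_2$ norm and $\|\cdot\|_1$ the $\ell_1$ norm. $\log$ is the natural logarithm. Networks: a depth-$d$ neural network is a function $f:\mathbb{R}^h\to\mathbb{R}$, $f(\mathbf{x})=\mathbf{w}_d^T\sigma_{d-1}(\mathbf{W}_{d-1}\sigma_{d-2}(\cdots\sigma_1(\mathbf{W}_1\mathbf{x})))$, where $\mathbf{W}_i\in\mathbb{R}^{k_{i+1}\times k_i}$ for $i=1,\dots,d-1$, $\mathbf{w}_d\in\mathbb{R}^{k_d}$, and the scalar activation functions $\sigma_i:\mathbb{R}\to\mathbb{R}$ (fixed) are applied entrywise. Given positive constants $M_F(i)$, $M_{1,\infty}(i)$, $i=1,\dots,d$, the parameter sets are: $\mathcal{W}_F$, all $(\mathbf{W}_1,\dots,\mathbf{W}_{d-1},\mathbf{w}_d)$ with $\|\mathbf{W}_i\|_F\le M_F(i)$ for $i\le d-1$ and $\|\mathbf{w}_d\|\le M_F(d)$; and $\mathcal{W}_{1,\infty}$, all such tuples with $\|\mathbf{W}_i\|_{1,\infty}\le M_{1,\infty}(i)$ for $i\le d-1$ and $\|\mathbf{w}_d\|_1\le M_{1,\infty}(d)$. $\mathcal{F}_{nn}$ is the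 set of all such networks with parameters in the given parameter set. Assumption A: each $\sigma_i$ is continuous, non-decreasing, satisfies $\sigma_i(0)\ge0$, and is $L_i$-Lipschitz with $L_i>0$ (these are the $L_i$ in the claim). Assumption B: for each $i=1,\dots,d-1$ there are positive constants $q(i)$ and $Q_\sigma(i)$ such that $\sigma_i(x_2)-\sigma_i(x_1)\ge Q_\sigma(i)(x_2-x_1)$ for all $0\le x_1\le x_2\le q(i)$. Neural net distance: $d_{\mathcal{F}_{nn}}(\mu,\nu)=\sup_{f\in\mathcal{F}_{nn}}|\mathbb{E}_{\mathbf{x}\sim\mu}f(\mathbf{x})-\mathbb{E}_{\mathbf{x}\sim\nu}f(\mathbf{x})|$. Class $\mathcal{P}_{uB}$: given $\Gamma_{uB}>0$, $\mathcal{P}_{uB}$ is the set of all Borel probability measures $\mu$ on $\mathbb{R}^h$ with unbounded support such that $\|\mathbb{E}_{\mathbf{x}\sim\mu}\mathbf{x}\|\le\Gamma_{uB}$ and, for some $\tau$ with $0<\tau\le\Gamma_{uB}$, $\mathbb{E}_{\mathbf{x}\sim\mu}e^{\mathbf{a}^T(\mathbf{x}-\mathbb{E}\mathbf{x})}\le e^{\|\mathbf{a}\|^2\tau^2/2}$ for all $\mathbf{a}\in\mathbb{R}^h$. Empirical measures: $\hat\mu_n$ puts mass $1/n$ on each of $n$ i.i.d. samples from $\mu$, and $\hat\nu_m$ puts mass $1/m$ on each of $m$ i.i.d. samples from $\nu$, the two samples being independent of each other. Average Rademacher complexity: $\mathcal{R}_n(\mathcal{F}_{nn},\mu)=\mathbb{E}_{\mathbf{x},\epsilon}\sup_{f\in\mathcal{F}_{nn}}\left|\frac1n\sum_{i=1}^n\epsilon_if(\mathbf{x}_i)\right|$,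 where $\mathbf{x}_1,\dots,\mathbf{x}_n$ are i.i.d. from $\mu$ and $\epsilon_1,\dots,\epsilon_n$ are independent and uniform on $\{-1,1\}$, independent of the $\mathbf{x}_i$. *)

(* Defs.v *)
From HB Require Import structures.
From mathcomp Require Import all_boot all_order all_algebra.
From mathcomp Require Import all_classical all_reals all_analysis.

Set Implicit Arguments.
Unset Strict Implicit.
Unset Printing Implicit Defensive.

Import Order.TTheory GRing.Theory Num.Theory.
Import numFieldNormedType.Exports.

Local Open Scope classical_set_scope.
Local Open Scope ring_scope.

(* R^p with its Borel sigma-algebra; convertible to the type of column vectors
   of size p. *)
Notation borelRn R p := (g_sigma_algebraType (@open 'cV[R]_p)).

Section Norms.
Context {R : realType}.

(* The library norm on matrices is the max norm, hence these definitions. *)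

Definition l2norm p (v : 'cV[R]_p) : R := Num.sqrt (\sum_(i < p) v i 0 ^+ 2).

Definition l1norm p (v : 'cV[R]_p) : R := \sum_(i < p) `|v i 0|.

Definition frobenius_norm p q (W : 'M[R]_(p, q)) : R :=
  Num.sqrt (\sum_(i < p) \sum_(j < q) W i j ^+ 2).

Definition max_row_l1norm p q (W : 'M[R]_(p, q)) : R :=
  \big[Num.max/0]_(i < p) \sum_(j < q) `|W i j|.

End Norms.

Section Networks.
Context {R : realType}.

(* [k i] is the width of layer i, counted from 1, so that the input dimension
   is [k 1].  Only the matrices [W i] with 1 <= i < d occur in a network of
   depth d >= 2, and then [d.-1.+1] is d. *)
Record parameters (k : nat -> nat) (d : nat) := MkParameters {
  weights : forall i, 'M[R]_(k i.+1, k i) ;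
  output_weights : 'cV[R]_(k d.-1.+1) }.

Section Network.
Variables (k : nat -> nat) (sigma : nat -> R -> R).

(* sigma_i (W_i (... sigma_1 (W_1 x))) *)
Fixpoint hidden_layer (W : forall i, 'M[R]_(k i.+1, k i)) (x : 'cV[R]_(k 1%N))
    (i : nat) : 'cV[R]_(k i.+1) :=
  match i with
  | 0 => x
  | j.+1 => map_mx (sigma j.+1) (W j.+1 *m hidden_layer W x j)
  end.

Definition network d (theta : parameters k d) (x : 'cV[R]_(k 1%N)) : R :=
  ((output_weights theta)^T *m hidden_layer (weights theta) x d.-1) 0 0.

Definition network_class d (Theta : set (parameters k d)) :
  set (borelRn R (k 1%N) -> R) := [set network theta | theta in Theta].

End Network.

Definition parameters_F k d (M : nat -> R) : set (parameters k d) :=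
  [set theta |
    (forall i, (1 <= i < d)%N -> frobenius_norm (weights theta i) <= M i) /\
    l2norm (output_weights theta) <= M d].

Definition parameters_1inf k d (M : nat -> R) : set (parameters k d) :=
  [set theta |
    (forall i, (1 <= i < d)%N -> max_row_l1norm (weights theta i) <= M i) /\
    l1norm (output_weights theta) <= M d].

Definition assumptionA (L : R) (s : R -> R) : Prop :=
  [/\ continuous s, {homo s : x y / x <= y}, 0 <= s 0, 0 < L
    & forall x y, `|s x - s y| <= L * `|x - y|].

Definition assumptionB (s : R -> R) : Prop :=
  exists q Q : R, [/\ 0 < q, 0 < Q &
    forall x1 x2, 0 <= x1 -> x1 <= x2 -> x2 <= q ->
      Q * (x2 - x1) <= s x2 - s x1].

End Networks.

Section SubGaussianClass.
Context {R : realType} (h : nat).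
Implicit Type mu : probability (borelRn R h) R.

Definition topological_support mu : set 'cV[R]_h :=
  [set x | forall U : set 'cV[R]_h, open U -> U x -> (0 < mu U)%E].

Definition mean_vector mu : 'cV[R]_h :=
  \col_(i < h) Rintegral mu setT (fun x : 'cV[R]_h => x i 0).

Definition class_uB (Gamma : R) : set (probability (borelRn R h) R) :=
  [set mu | [/\
    (forall r : R, exists2 x, topological_support mu x & r < l2norm x),
    (forall i : 'I_h,
      mu.-integrable setT (fun x : 'cV[R]_h => (x i 0)%:E)),
    l2norm (mean_vector mu) <= Gamma
    & exists tau : R, 0 < tau <= Gamma /\
      forall a : 'cV[R]_h,
        (\int[mu]_x (expR ((a^T *m ((x : 'cV[R]_h) - mean_vector mu)) 0 0))%:E
          <= (expR (l2norm a ^+ 2 * tau ^+ 2 / 2))%:E)%E]].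

End SubGaussianClass.

Section IIDPower.
Context d (T : measurableType d) (R : realType).

Definition tuple_cons n (xy : T * n.-tuple T) : n.+1.-tuple T :=
  [the n.+1.-tuple T of xy.1 :: xy.2].

Lemma measurable_tuple_cons n :
  measurable_fun [set: T * n.-tuple T] (@tuple_cons n).
Proof. by apply: measurable_cons. Qed.

HB.instance Definition _ n :=
  isMeasurableFun.Build _ _ _ _ (@tuple_cons n) (@measurable_tuple_cons n).

(* The law of n independent samples from mu. *)
Fixpoint iid_power (mu : probability T R) n : probability (n.-tuple T) R :=
  match n with
  | 0 => \d_([tuple] : 0.-tuple T)
  | n'.+1 => distribution (mu \x iid_power mu n')%E (@tuple_cons n')
  end.

Lemma iid_power_box (mu : probability T R) n (A : 'I_n -> set T) :
  (forall i, measurable (A i)) ->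
  iid_power mu n [set x | forall i, A i (tnth x i)]
    = (\prod_(i < n) mu (A i))%E.
Proof.
elim: n A => [|n IHn] A mA /=.
  by rewrite big_ord0 diracE mem_set// => -[].
rewrite big_ord_recl -(IHn (fun i => A (lift ord0 i))) => [|i]; last exact: mA.
rewrite /distribution /pushforward -product_measure1E//; last first.
  rewrite (_ : [set _ | _] =
      \big[setI/setT]_(i < n) ((@tnth _ T ^~ i) @^-1` A (lift ord0 i))).
    apply: bigsetI_measurable => i _.
    by rewrite -[X in measurable X]setTI; exact: measurable_tnth.
  rewrite -bigcap_seq; apply/seteqP; split=> [x Ax i _|x Ax i]; first exact: Ax.
  by apply: Ax; rewrite /= mem_index_enum.
congr (_ _); apply/seteqP; split=> -[x y] /=.
  move=> Axy; split; first exact: (Axy ord0).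
  by move=> i; move: (Axy (lift ord0 i)); rewrite tnthS.
move=> [Ax Ay] i; have [j ->|->] := unliftP ord0 i; last exact: Ax.
by rewrite tnthS; exact: Ay.
Qed.

(* [point] is never used as x has length n. *)
Definition empirical_measure n (x : n.-tuple T) : {measure set T -> \bar R} :=
  mscale (n%:R^-1)%:nng (msum (fun i => \d_(nth point x i)) n).

Definition F_distance (F : set (T -> R)) (mu nu : {measure set T -> \bar R}) :
    \bar R :=
  ereal_sup
    [set `| \int[mu]_x (f x)%:E - \int[nu]_x (f x)%:E |%E | f in F].

(* The expectation over the signs is the average over the 2 ^ n sign
   vectors. *)
Definition rademacher_complexity n (F : set (T -> R)) (mu : probability T R) :
    \bar R :=
  (\int[iid_power mu n]_x
    (((2 ^ n)%:R^-1)%:E * \sum_(e : {ffun 'I_n -> bool})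
      ereal_sup [set (`| n%:R^-1 *
        (\sum_(i < n) (-1) ^+ e i * f (tnth x i))%R |%R)%:E | f in F]))%E.

End IIDPower.

(* Main.v *)
(* Every network in the class is Lipschitz for the Euclidean norm, with constant
   C = prod M * prod L.  The error of the empirical distance is at most
   G(x) + G'(y), where G(x) = sup_f |E_mu f - (1/n) sum_i f(x_i)| and G' is its
   analogue for nu, and by symmetrization E G <= 2 R_n and E G' <= 2 R_m.

   The concentration of G + G' rests on a Laplace bound
   E exp(a (g - E g)) <= exp(a^2 h Gamma^2) for 1-Lipschitz g under a law in the
   class P_uB.  With x' an independent copy of x, Jensen's inequality gives
   E exp(a (g - E g)) <= E cosh(a |x - x'|), and since cosh o sqrt is convex,
   cosh(a |z|) is at most the mean of exp(a s.z) over the sign vectors s, whose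
   expectation is controlled by the sub-Gaussian hypothesis as |a s|^2 = a^2 h.
   The bound tensorizes, and Chernoff's inequality even yields the confidence
   level 1 - delta^2. *)

Require Import Defs.
From HB Require Import structures.
From mathcomp Require Import all_boot all_order all_algebra.
From mathcomp Require Import all_classical all_reals all_analysis.
From mathcomp Require Import measurable_realfun ring lra.

Set Implicit Arguments.
Unset Strict Implicit.
Unset Printing Implicit Defensive.

Import Order.TTheory GRing.Theory Num.Theory.
Import numFieldNormedType.Exports.

Local Open Scope classical_set_scope.
Local Open Scope ring_scope.

(** * Lipschitz functions for a cost *)

Section CostFunctions.
Context {R : realType}.

(** The change is however at most C/n times the distance moved, which is why the argument is phrased
    with Lipschitz functions for a cost. A supremum of C-Lipschitz functions is again C-Lipschitz,
    and a Lipschitz function is measurable as soon as the cost is separable; this also disposes of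
    the measurability of suprema over an uncountable class. The constant h Gamma^2 has no factor 1/2
    because two independent points are involved: x and x' each contribute at most exp(a^2 h tau^2 /
    2), with tau at most Gamma. For n points and Lipschitz constant C/n the exponent sums to n
    (C/n)^2 h Gamma^2 = C^2 h Gamma^2 / n, hence the factor 1/n + 1/m for two samples. *)

Definition lip T (c : T -> T -> R) (a : R) (g : T -> R) : Prop :=
  forall x y, `|g x - g y| <= a * c x y.

(* A countable dense family replaces the topology: the sigma-algebra of a tuple
   or product type is not presented by its open sets. *)
Definition separable_cost dT (T : measurableType dT) (c : T -> T -> R) : Prop :=
  [/\ (forall x y, 0 <= c x y), (forall x, c x x = 0),
      (forall y, measurable_fun [set: T] (c ^~ y))
    & exists (D : countType) (q : D -> T),
        forall x e, 0 < e -> exists i, c x (q i) < e].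

(** With a sum of costs, an a-Lipschitz function is a-Lipschitz in each argument with the other one
    fixed, so a single constant serves through the whole tensorization. *)
Definition prod_cost T1 T2 (c1 : T1 -> T1 -> R) (c2 : T2 -> T2 -> R)
  (x y : T1 * T2) : R := c1 x.1 y.1 + c2 x.2 y.2.

Definition tuple_cost T (c : T -> T -> R) n (x y : n.-tuple T) : R :=
  \sum_(i < n) c (tnth x i) (tnth y i).

Lemma lipZ T (c : T -> T -> R) a b g :
  0 <= b -> lip c a g -> lip c (b * a) (fun x => b * g x).
Proof.
by move=> b0 gl x y; rewrite -mulrBr normrM ger0_norm// -mulrA ler_wpM2l.
Qed.

(* A Lipschitz function is the infimum of [g (q i) + a * c x (q i)] over a
   countable dense family [q]. *)
Lemma lip_measurable dT (T : measurableType dT) (c : T -> T -> R) a g :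
  separable_cost c -> 0 <= a -> lip c a g -> measurable_fun [set: T] g.
Proof.
move=> [c0 cxx mc [D [q qd]]] a0 gl.
apply: (measurability _ (RGenInftyO.measurableE R)) => // _ [_ [r ->] <-].
rewrite setTI (_ : _ @^-1` _ =
  \bigcup_i [set x | g (q i) + a * c x (q i) < r]); last first.
  apply/seteqP; split=> [x|x [i _]] /=; rewrite in_itv/=.
    (* Replacing [g x] by [g (q i) + a * c x (q i)] costs at most [2 * a * c x (q i)]; the added 1
       keeps the divisor positive when [a] is 0. *)
    have a1 : 0 < 2 * a + 1 by rewrite ltr_wpDl// mulr_ge0.
    move=> gr; have [i ci] : exists i, c x (q i) < (r - g x) / (2 * a + 1).
      by apply: qd; rewrite divr_gt0// subr_gt0.
    exists i => //=; move: ci; rewrite ltr_pdivlMr//.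
    have := gl x (q i); rewrite ler_norml => /andP[+ _].
    by have := c0 x (q i); nra.
  have := gl x (q i); rewrite ler_norml => /andP[_ +] /=.
  by lra.
apply: countable_bigcupT_measurable => [|i]; first exact: countableP.
have mh : measurable_fun [set: T] (fun x => g (q i) + a * c x (q i)).
  by apply: measurable_funD => //; apply: measurable_funM.
rewrite [X in measurable X](_ : _ =
  [set: T] `&` (fun x => g (q i) + a * c x (q i)) @^-1` `]-oo, r[%classic).
  by apply: mh => //; exact: measurable_itv.
by rewrite setTI; apply/seteqP; split=> x /=; rewrite in_itv.
Qed.

Lemma separable_prod d1 d2 (T1 : measurableType d1) (T2 : measurableType d2)
    (c1 : T1 -> T1 -> R) (c2 : T2 -> T2 -> R) :
  separable_cost c1 -> separable_cost c2 -> separable_cost (prod_cost c1 c2).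
Proof.
move=> [c10 c1xx mc1 [D1 [q1 qd1]]] [c20 c2xx mc2 [D2 [q2 qd2]]]; split.
- by move=> x y; rewrite addr_ge0.
- by move=> x; rewrite /prod_cost c1xx c2xx addr0.
- move=> y; apply: measurable_funD.
  + exact: measurableT_comp (mc1 y.1) measurable_fst.
  + exact: measurableT_comp (mc2 y.2) measurable_snd.
- exists (D1 * D2)%type, (fun i => (q1 i.1, q2 i.2)) => x e e0.
  have [i ci] := qd1 x.1 (e / 2) (divr_gt0 e0 (ltr0n _ 2)).
  have [j cj] := qd2 x.2 (e / 2) (divr_gt0 e0 (ltr0n _ 2)).
  by exists (i, j); rewrite [ltRHS]splitr ltrD.
Qed.

Lemma separable_tuple dT (T : measurableType dT) (c : T -> T -> R) n :
  separable_cost c -> separable_cost (@tuple_cost T c n).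
Proof.
move=> [c0 cxx mc [D [q qd]]]; split.
- by move=> x y; apply: sumr_ge0 => i _.
- by move=> x; apply: big1 => i _.
- move=> y; apply: measurable_sum => i.
  exact: measurableT_comp (mc (tnth y i)) (measurable_tnth i).
- exists (n.-tuple D)%type, (fun i => map_tuple q i) => x e e0.
  (* Dividing by n + 1 rather than n covers the empty tuple and makes the sum of the n errors
     strictly less than [e]. *)
  have /(_ _)/cid-/all_sig[f fP] : forall i : 'I_n, exists j,
      c (tnth x i) (q j) < e / n.+1%:R.
    by move=> i; apply: qd; rewrite divr_gt0.
  exists [tuple f i | i < n].
  apply: (@le_lt_trans _ _ (\sum_(i < n) (e / n.+1%:R))).
    by apply: ler_sum => i _; rewrite tnth_map tnth_mktuple ltW.
  rewrite sumr_const card_ord -[ltLHS]mulr_natr -mulrA gtr_pMr//.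
  by rewrite mulrC ltr_pdivrMr// mul1r ltr_nat.
Qed.

Lemma tuple_cost_cons dT (T : measurableType dT) (c : T -> T -> R) n
    (x y : T * n.-tuple T) :
  tuple_cost c (tuple_cons x) (tuple_cons y) =
  prod_cost c (@tuple_cost T c n) x y.
Proof.
rewrite /tuple_cost big_ord_recl /prod_cost; congr (_ + _).
by apply: eq_bigr => i _; rewrite !tnthS.
Qed.

End CostFunctions.

(** * Laplace transforms of Lipschitz functions *)

Section LaplaceBound.
Context {R : realType}.

Lemma Rintegral_dist_le dT (T : measurableType dT) (P : probability T R)
    (f g : T -> R) b :
  P.-integrable setT (EFin \o f) -> P.-integrable setT (EFin \o g) ->
  (forall x, `|f x - g x| <= b) ->
  `|\int[P]_x f x - \int[P]_x g x| <= b.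
Proof.
move=> fi gi fg; rewrite -RintegralB//.
have fgi : P.-integrable setT (EFin \o (fun x => f x - g x)).
  exact: (integrableB _ fi gi).
apply: le_trans (le_normr_Rintegral measurableT fgi) _.
rewrite -[leRHS]mulr1 -[1]/(fine 1%E) -(probability_setT P).
rewrite -(Rintegral_cst P measurableT); apply: le_Rintegral => //.
- exact: integrable_abse fgi.
- exact: finite_measure_integrable_cst.
Qed.

Lemma measurable_expRB dT (T : measurableType dT) (g : T -> R) (b : R) :
  measurable_fun setT g -> measurable_fun setT (fun x => (expR (g x - b))%:E).
Proof.
move=> mg; apply/measurable_EFinP; apply: (measurableT_comp (@measurable_expR R)).
exact: measurable_funB mg (measurable_cst b).
Qed.

(* Without the customary factor 1/2 in the exponent: the variance proxy of a
   1-Lipschitz function is [2 * v]. *)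
Definition laplace_bounded dT (T : measurableType dT) (c : T -> T -> R)
    (P : probability T R) (v : R) : Prop :=
  forall a g, 0 <= a -> lip c a g ->
    P.-integrable setT (EFin \o g) /\
    (\int[P]_x (expR (g x - \int[P]_y g y))%:E <= (expR (a ^+ 2 * v))%:E)%E.

(** Conditioning on the first coordinate: g - E g splits into g(x, y) - g1(x), handled by the second
    law for each fixed x, and g1(x) - E g1, handled by the first law because the partial mean g1 is
    again a-Lipschitz. *)
Lemma laplace_prod d1 d2 (T1 : measurableType d1) (T2 : measurableType d2)
    c1 c2 (P1 : probability T1 R) (P2 : probability T2 R) v1 v2 :
  separable_cost c1 -> separable_cost c2 ->
  laplace_bounded c1 P1 v1 -> laplace_bounded c2 P2 v2 ->
  laplace_bounded (prod_cost c1 c2) (P1 \x P2)%E (v1 + v2).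
Proof.
move=> s1 s2 L1 L2 a g a0 gl.
have [c10 c1xx _ _] := s1; have [c20 c2xx _ _] := s2.
have gl2 x : lip c2 a (fun y => g (x, y)).
  by move=> y y'; apply: le_trans (gl _ _) _; rewrite /prod_cost c1xx add0r.
have gl1 y x x' : `|g (x, y) - g (x', y)| <= a * c1 x x'.
  by apply: le_trans (gl _ _) _; rewrite /prod_cost c2xx addr0.
have gi2 x : P2.-integrable setT (EFin \o (fun y => g (x, y))).
  by have [] := L2 _ _ a0 (gl2 x).
have mg : measurable_fun setT g := lip_measurable (separable_prod s1 s2) a0 gl.
have gi : (P1 \x P2)%E.-integrable setT (EFin \o g).
  apply/integrableP; split; first exact/measurable_EFinP.
  have mabs : measurable_fun setT (fun z => `|g z|%:E).
    by apply/measurable_EFinP; exact: measurableT_comp.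
  rewrite fubini_tonelli1//=.
  (* Joint integrability: the partial integral of |g| is itself a-Lipschitz, so the first law
     integrates it. *)
  pose h x := \int[P2]_y `|g (x, y)|.
  have hE x : (h x)%:E = (\int[P2]_y `|(g (x, y))%:E|)%E.
    rewrite /h /Rintegral fineK//.
    by apply: integrable_fin_num => //; exact: integrable_abse (gi2 x).
  have hl : lip c1 a h.
    move=> x x'; apply: Rintegral_dist_le.
    - exact: integrable_abse (gi2 x).
    - exact: integrable_abse (gi2 x').
    - by move=> y; apply: le_trans (gl1 y x x'); exact: ler_dist_dist.
  have [/integrableP[_ hi] _] := L1 _ _ a0 hl.
  apply: le_lt_trans hi; apply: ge0_le_integral => //.
  - by move=> x _; apply: integral_ge0 => y _; rewrite lee_fin.
  - by apply: measurable_fun_fubini_tonelli_F => // z; rewrite lee_fin.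
  - apply: measurableT_comp => //; apply/measurable_EFinP.
    exact: lip_measurable s1 a0 hl.
  - by move=> x _; rewrite /= /fubini_F -hE lee_fin ler_norm.
split => //.
pose g1 x := \int[P2]_y g (x, y).
have g1l : lip c1 a g1.
  by move=> x x'; apply: Rintegral_dist_le => // y; exact: gl1.
have mE : \int[(P1 \x P2)%E]_z g z = \int[P1]_x g1 x.
  rewrite /Rintegral -integral12_prod_meas1//; congr fine.
  apply: eq_integral => x _; rewrite /fubini_F /g1 /Rintegral fineK//.
  exact: integrable_fin_num (gi2 x).
set m := Rintegral _ _ _ in mE *.
have mexp : measurable_fun setT (fun z => (expR (g z - m))%:E).
  exact: measurable_expRB.
rewrite fubini_tonelli1//.
have mg1 : measurable_fun setT g1 := lip_measurable s1 a0 g1l.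
have mg1exp : measurable_fun setT (fun x => (expR (g1 x - m))%:E).
  exact: measurable_expRB.
apply: (@le_trans _ _ (\int[P1]_x ((expR (a ^+ 2 * v2))%:E *
    (expR (g1 x - m))%:E))%E).
  apply: ge0_le_integral => //.
  - by move=> x _; apply: integral_ge0 => y _; rewrite lee_fin expR_ge0.
  - by apply: measurable_fun_fubini_tonelli_F => // z; rewrite lee_fin expR_ge0.
  - exact: measurable_funeM.
  - move=> x _; rewrite /fubini_F.
    under eq_integral => y _.
      rewrite (_ : g (x, y) - m = (g1 x - m) + (g (x, y) - g1 x)); last by ring.
      rewrite expRD EFinM; over.
    have [_ /= e2] := L2 _ _ a0 (gl2 x).
    rewrite ge0_integralZl//=.
    + by rewrite muleC; apply: lee_pmul => //; rewrite ?lee_fin ?expR_ge0//;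
        apply: integral_ge0 => y _; rewrite lee_fin expR_ge0.
    + have /integrableP[/measurable_EFinP mgx _] := gi2 x.
      exact: measurable_expRB.
rewrite ge0_integralZl//.
have [_ e1] := L1 _ _ a0 g1l.
rewrite mE mulrDr addrC expRD EFinM lee_pmul ?lee_fin ?expR_ge0//.
by apply: integral_ge0 => y _; rewrite lee_fin expR_ge0.
Qed.

Lemma ge0_integral_iid_powerS dT (T : measurableType dT) (P : probability T R)
    n (f : n.+1.-tuple T -> \bar R) :
  measurable_fun setT f -> (forall z, 0 <= f z)%E ->
  (\int[iid_power P n.+1]_z f z =
   \int[P \x iid_power P n]_z f (tuple_cons z))%E.
Proof. by move=> mf f0; rewrite ge0_integral_distribution. Qed.

Lemma laplace_iid dT (T : measurableType dT) (c : T -> T -> R)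
    (P : probability T R) v n :
  separable_cost c -> laplace_bounded c P v ->
  laplace_bounded (@tuple_cost R T c n) (iid_power P n) (n%:R * v).
Proof.
move=> sc L; elim: n => [|n IHn] a g a0 gl.
  have g0 : g = cst (g [tuple]) by apply/funext => x; rewrite [x]tuple0.
  rewrite g0; split; first exact: finite_measure_integrable_cst.
  have P1 := @probability_setT _ _ _ (iid_power P 0).
  rewrite Rintegral_cst// [fine _](congr1 fine P1) mulr1 /= subrr expR0.
  rewrite mul0r mulr0 expR0.
  by rewrite integral_cst// [_ setT]P1 mul1e.
have sn := separable_tuple n sc.
have gl' : lip (prod_cost c (@tuple_cost R T c n)) a (g \o @tuple_cons _ _ n).
  by move=> x y; apply: le_trans (gl _ _) _; rewrite tuple_cost_cons.
have [gi ge] := laplace_prod sc sn L IHn a0 gl'.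
have mg : measurable_fun setT g := lip_measurable (separable_tuple _ sc) a0 gl.
have igE : (\int[iid_power P n.+1]_x (g x)%:E =
    \int[P \x iid_power P n]_x (g (tuple_cons x))%:E)%E.
  by rewrite integral_distribution//; exact/measurable_EFinP.
split.
  apply/integrableP; split; first exact/measurable_EFinP.
  rewrite ge0_integral_iid_powerS//=; last first.
    by apply/measurable_EFinP; exact: measurableT_comp.
  by have /integrableP[] := gi.
rewrite ge0_integral_iid_powerS//=; last exact: measurable_expRB.
by rewrite /Rintegral igE -natr1 mulrDl mul1r addrC.
Qed.

End LaplaceBound.

(** * Sub-Gaussian vectors *)

Section HyperbolicCosine.
Context {R : realType}.
Implicit Types a b p q r x y : R.

(** Twice the hyperbolic cosine; this normalization accounts for the powers of two below. *)
Definition ch2 x : R := expR x + expR (- x).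

Lemma ch2_ge0 x : 0 <= ch2 x.
Proof. by rewrite addr_ge0 ?expR_ge0. Qed.

Lemma ch2_norm x : ch2 `|x| = ch2 x.
Proof. by case: (ger0P x) => // _; rewrite /ch2 opprK addrC. Qed.

(** For 0 <= x <= y the difference factors as (e^y - e^x)(1 - e^(-x-y)), a product of nonnegative
    terms. *)
Lemma ch2_le x y : `|x| <= y -> ch2 x <= ch2 y.
Proof.
rewrite -ch2_norm; move: `|x| (normr_ge0 x) => {}x x0 xy.
have yN : expR y * expR (- y) = 1 by rewrite -expRD subrr expR0.
have xN : expR x * expR (- x) = 1 by rewrite -expRD subrr expR0.
have x1 : 1 <= expR x by rewrite -expR0 ler_expR.
have xyE : expR x <= expR y by rewrite ler_expR.
have h : 0 <= (expR y - expR x) * (1 - expR (- x) * expR (- y)).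
  rewrite mulr_ge0 ?subr_ge0// mulr_ile1 ?expR_ge0// -expR0 ler_expR; lra.
have : (expR y - expR x) * (1 - expR (- x) * expR (- y)) = ch2 y - ch2 x.
  rewrite /ch2; ring: yN xN.
by move=> e; rewrite e subr_ge0 in h.
Qed.

(** Induction on k: the loss in passing from k to k + 1 is governed by (x^k - y^k)(x - y) >= 0, both
    factors having the same sign. *)
Lemma powers_mean_le x y k :
  0 <= x -> 0 <= y -> ((x + y) / 2) ^+ k *+ 2 <= x ^+ k + y ^+ k.
Proof.
move=> x0 y0; elim: k => [|k IHk]; first by rewrite !expr0.
have h : 0 <= (x ^+ k - y ^+ k) * (x - y).
  have [xy|/ltW yx] := leP x y.
    by rewrite mulr_le0 ?subr_le0// lerXn2r.
  by rewrite mulr_ge0 ?subr_ge0// lerXn2r.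
have h2 : 0 <= (x + y) / 2 by rewrite divr_ge0// addr_ge0.
have := ler_wpM2l h2 IHk; rewrite !exprS -mulrnAr => /le_trans; apply.
by move: h; nra.
Qed.

(* The midpoint convexity of [cosh \o sqrt], read off the power series. *)
Lemma ch2_convex p q r :
  2 * r ^+ 2 = p ^+ 2 + q ^+ 2 -> 2 * ch2 r <= ch2 p + ch2 q.
Proof.
move=> rpq.
have cvE x := is_cvg_series_exp_coeff x.
pose c x : R^nat := exp_coeff x + exp_coeff (- x).
have cvc x : cvgn (series (c x)) by apply: is_cvg_seriesD.
have cE x : ch2 x = limn (series (c x)) by rewrite lim_seriesD.
rewrite mulr_natl mulr2n !cE -!lim_seriesD//.
apply: lim_series_le => [||n]; [exact: is_cvg_seriesD..|].
rewrite /c /= !fctE /= -!mulrDl ler_pM2r ?invr_gt0 ?ltr0n ?fact_gt0//.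
(* Odd terms of the series cancel; an even term is a power of the squared argument, to which the
   convexity of powers applies. *)
rewrite -[n]odd_double_half -muln2 mulnC.
case: (odd n); first by rewrite /= add1n !exprS !exprM !sqrrN !mulNr !subrr addr0.
rewrite add0n !exprM !sqrrN.
have := @powers_mean_le _ _ n./2 (sqr_ge0 p) (sqr_ge0 q).
rewrite -rpq mulrAC divff// mul1r.
lra.
Qed.

(** The product formula gives ch2 a * ch2 b = ch2 (a + b) + ch2 (a - b), and a^2 + b^2 is the mean
    of the squares of a + b and a - b. *)
Lemma ch2_sqrtD a b : 2 * ch2 (Num.sqrt (a ^+ 2 + b ^+ 2)) <= ch2 a * ch2 b.
Proof.
apply: (@le_trans _ _ (ch2 (a + b) + ch2 (a - b))).
  by apply: ch2_convex; rewrite sqr_sqrtr ?addr_ge0 ?sqr_ge0//; ring.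
rewrite /ch2 !opprD !opprK mulrDl !mulrDr -!expRD.
lra.
Qed.

(** In terms of cosh: cosh |z| is at most the product of the cosh (z i). Convexity is thus used one
    coordinate at a time, and the sign vectors appear only when the product is expanded. *)
Lemma ch2_sqrt_sum n (z : 'I_n -> R) :
  2 ^+ n * ch2 (Num.sqrt (\sum_(i < n) z i ^+ 2)) <=
  2 * \prod_(i < n) ch2 (z i).
Proof.
elim: n z => [|n IHn] z.
  by rewrite !big_ord0 sqrtr0 expr0 /ch2 oppr0 expR0; lra.
have S0 : 0 <= \sum_(i < n) z (lift ord0 i) ^+ 2.
  by apply: sumr_ge0 => i _; exact: sqr_ge0.
rewrite !big_ord_recl /= -[X in _ + X](sqr_sqrtr S0).
have h1 := ch2_sqrtD (z ord0) (Num.sqrt (\sum_(i < n) z (lift ord0 i) ^+ 2)).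
have h2 := IHn (fun i => z (lift ord0 i)).
rewrite exprS -mulrA mulrCA.
apply: (le_trans (ler_wpM2l (exprn_ge0 n (ler0n R 2)) h1)).
rewrite mulrCA [leRHS]mulrCA; exact: ler_wpM2l (ch2_ge0 _) _ _ h2.
Qed.

Lemma prod_ch2 n (z : 'I_n -> R) :
  \prod_(i < n) ch2 (z i) =
  \sum_(e : {ffun 'I_n -> bool}) expR (\sum_(i < n) (-1) ^+ e i * z i).
Proof.
under eq_bigr => i _.
  rewrite (_ : ch2 (z i) = \sum_(b : bool) expR ((-1) ^+ b * z i)); last first.
    by rewrite big_bool /= expr1 expr0 mulN1r mul1r addrC.
  over.
by rewrite bigA_distr_bigA; apply: eq_bigr => e _; rewrite expR_sum.
Qed.

(* Jensen's inequality for [cosh \o sqrt] over the [2 ^ n] sign vectors, the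
   mean of [(\sum_i +-z i) ^+ 2] being [\sum_i z i ^+ 2]. *)
Lemma ch2_sqrt_signs n (z : 'I_n -> R) :
  2 ^+ n * ch2 (Num.sqrt (\sum_(i < n) z i ^+ 2)) <=
  2 * \sum_(e : {ffun 'I_n -> bool}) expR (\sum_(i < n) (-1) ^+ e i * z i).
Proof. by rewrite -prod_ch2; exact: ch2_sqrt_sum. Qed.

End HyperbolicCosine.

(** * Laplace bound for the Euclidean distance *)

Section Euclidean.
Context {R : realType} (h : nat).
Implicit Type u : 'cV[R]_h.

Lemma l2norm_ge0 u : 0 <= l2norm u.
Proof. exact: sqrtr_ge0. Qed.

Lemma sqr_l2norm u : l2norm u ^+ 2 = \sum_(i < h) u i 0 ^+ 2.
Proof. by rewrite sqr_sqrtr// sumr_ge0// => i _; exact: sqr_ge0. Qed.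

Lemma l2norm_le_l1norm u : l2norm u <= l1norm u.
Proof.
have l1_ge0 : 0 <= l1norm u by apply: sumr_ge0.
rewrite -[leRHS]ger0_norm// -sqrtr_sqr ler_wsqrtr// expr2 {1}/l1norm mulr_suml.
apply: ler_sum => i _; rewrite -[leLHS]ger0_norm ?sqr_ge0// expr2 normrM ler_wpM2l//.
by rewrite /l1norm (bigD1 i)//= lerDl sumr_ge0.
Qed.

Definition l2dist (x y : 'cV[R]_h) : R := l2norm (x - y).

Lemma measurable_coord (i : 'I_h) :
  measurable_fun [set: borelRn R h] (fun x : borelRn R h => (x : 'cV[R]_h) i 0).
Proof.
apply: (measurability _ (RGenInftyO.measurableE R)) => // _ [_ [r ->] <-].
rewrite setTI; apply: sub_sigma_algebra => /=.
apply: (@open_comp _ _ (fun x : 'cV[R]_h => x i 0)); last exact: interval_open.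
by move=> x _; exact: coord_continuous.
Qed.

Lemma separable_l2dist : @separable_cost R _ (borelRn R h) l2dist.
Proof.
split.
- by move=> x y; exact: l2norm_ge0.
- move=> x; rewrite /l2dist subrr /l2norm big1 ?sqrtr0// => i _.
  by rewrite mxE expr0n.
- move=> y; have msqrt : measurable_fun [set: R] Num.sqrt.
    by apply: nondecreasing_measurable => // a b; exact: ler_wsqrtr.
  apply: (measurableT_comp msqrt).
  apply: measurable_sum => i; apply: measurable_funX.
  under eq_fun do rewrite !mxE.
  exact: measurable_funB (measurable_coord i) (measurable_cst _).
(* Rational vectors are dense; bounding the Euclidean norm by the l1 norm reduces the approximation
   to single coordinates. *)
- exists 'cV[rat]_h, (map_mx ratr) => x e e0.
  have /(_ _)/cid-/all_sig[f fP] : forall i : 'I_h, exists q : rat,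
      `|x i 0 - ratr q| < e / h.+1%:R.
    move=> i; have : 0 < e / h.+1%:R by rewrite divr_gt0.
    move: (e / _) => r r0; have [|q] := @rat_in_itvoo R (x i 0 - r) (x i 0 + r).
      by lra.
    by rewrite in_itv/= => /andP[q1 q2]; exists q; rewrite ltr_norml; lra.
  exists (\col_i f i); apply: le_lt_trans (l2norm_le_l1norm _) _.
  apply: (@le_lt_trans _ _ (\sum_(i < h) (e / h.+1%:R))).
    by apply: ler_sum => i _; rewrite !mxE ltW.
  rewrite sumr_const card_ord -[ltLHS]mulr_natr -mulrA gtr_pMr//.
  by rewrite mulrC ltr_pdivrMr// mul1r ltr_nat.
Qed.

(* The lower bound [expR t >= 1 + t] is Jensen's inequality in this case. *)
Lemma integral_expRB_ge1 dT (T : measurableType dT) (P : probability T R)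
    (g : T -> R) :
  P.-integrable setT (EFin \o g) ->
  (1 <= \int[P]_x (expR (g x - \int[P]_y g y))%:E)%E.
Proof.
move=> gi; set m := Rintegral _ _ _; set B := integral _ _ _.
have /integrableP[/measurable_EFinP mg _] := gi.
have mB := measurable_expRB m mg.
have ci r : P.-integrable setT (EFin \o (fun=> r : R)).
  exact: finite_measure_integrable_cst.
have gmi : P.-integrable setT (EFin \o (fun x => g x - m)).
  exact: (integrableB measurableT gi (ci m)).
have li : P.-integrable setT (EFin \o (fun x => 1 + (g x - m))).
  exact: (integrableD measurableT (ci 1) gmi).
have lE : (\int[P]_x (1 + (g x - m))%:E = 1)%E.
  have c1 r : \int[P]_x (fun=> r : R) x = r.
    by rewrite Rintegral_cst// [fine _](congr1 fine (probability_setT P)) mulr1.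
  have l1 : \int[P]_x (1 + (g x - m)) = 1.
    by rewrite RintegralD// RintegralB// !c1 subrr addr0.
  move: (congr1 EFin l1); rewrite /Rintegral fineK//.
  exact: (integrable_fin_num measurableT li).
(* The exponential need not be integrable; an infinite integral satisfies the bound trivially. *)
have [Boo|Bfin] := eqVneq B +oo%E; first by rewrite Boo leey.
rewrite -lE; apply: le_integral => //.
  apply/integrableP; split => //; rewrite ltey; apply: contra Bfin.
  by under eq_integral do rewrite /= ger0_norm ?expR_ge0//.
by move=> x _; rewrite lee_fin expR_ge1Dx.
Qed.

Definition signed_vector (a : R) (e : {ffun 'I_h -> bool}) : 'cV[R]_h :=
  \col_i (a * (-1) ^+ e i).

Lemma sqr_l2norm_signed a e : l2norm (signed_vector a e) ^+ 2 = a ^+ 2 * h%:R.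
Proof.
rewrite sqr_l2norm (eq_bigr (fun=> a ^+ 2)); last first.
  by move=> i _; rewrite mxE exprMn sqrr_sign mulr1.
by rewrite sumr_const card_ord mulr_natr.
Qed.

(** The centre z cancels in (x - z) - (y - z). Inserting it separates each exponential into a factor
    in x and a factor in y, both in the centred form of the sub-Gaussian hypothesis once z is the
    mean. *)
Lemma ch2_l2dist_signs a (g : 'cV[R]_h -> R) (x y z : 'cV[R]_h) :
  0 <= a -> lip l2dist a g ->
  2 ^+ h * ch2 (g x - g y) <= 2 * \sum_(e : {ffun 'I_h -> bool})
    expR (((signed_vector a e)^T *m (x - z)) 0 0) *
    expR (((signed_vector (- a) e)^T *m (y - z)) 0 0).
Proof.
move=> a0 gl.
apply: (@le_trans _ _
  (2 ^+ h * ch2 (Num.sqrt (\sum_(i < h) (a * (x - y) i 0) ^+ 2)))).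
  rewrite ler_wpM2l// ch2_le//; apply: le_trans (gl x y) _.
  under eq_bigr do rewrite exprMn.
  by rewrite -mulr_sumr sqrtrM ?sqr_ge0// sqrtr_sqr ger0_norm.
apply: (le_trans (ch2_sqrt_signs _)); rewrite ler_wpM2l// ler_sum// => e _.
rewrite -expRD le_eqVlt; apply/orP; left; apply/eqP; congr expR.
rewrite !mxE -big_split/=; apply: eq_bigr => i _; rewrite !mxE.
ring.
Qed.

(** Extended coefficients are allowed because they will include exponential moments not yet known to
    be finite. *)
Lemma ge0_integral_lincomb dT (T : measurableType dT) (P : probability T R)
    (r : R) (a b : \bar R) (p q : T -> \bar R) :
  0 <= r -> (0 <= a)%E -> (0 <= b)%E ->
  measurable_fun setT p -> measurable_fun setT q ->
  (forall x, 0 <= p x)%E -> (forall x, 0 <= q x)%E ->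
  (\int[P]_x (r%:E * (a * p x + b * q x)) =
   r%:E * (a * \int[P]_x p x + b * \int[P]_x q x))%E.
Proof.
move=> r0 a0 b0 mp mq p0 q0.
have map := measurable_funeM a mp; have mbq := measurable_funeM b mq.
have ap0 x : (0 <= a * p x)%E by exact: mule_ge0.
have bq0 x : (0 <= b * q x)%E by exact: mule_ge0.
rewrite ge0_integralZl_EFin//; last 2 first.
- by move=> x _; rewrite adde_ge0.
- exact: emeasurable_funD.
by rewrite ge0_integralD// !ge0_integralZl.
Qed.

(** Let A and B be the means of exp(g - m) and exp(m - g). Integrating the sign-vector bound on ch2
    (g x - g y) in y and then in x gives A B <= kappa^2, and Jensen's inequality B >= 1 leaves A <=
    kappa^2. The independent copy is just the second integration variable. *)
Lemma laplace_l2dist (Gamma : R) (mu : probability (borelRn R h) R) :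
  class_uB Gamma mu ->
  @laplace_bounded R _ (borelRn R h) l2dist mu (h%:R * Gamma ^+ 2).
Proof.
move=> [_ xi _ [tau [/andP[tau0 tauG] mgf]]] a g a0 gl.
have mg : measurable_fun setT g := lip_measurable separable_l2dist a0 gl.
have gi : mu.-integrable setT (EFin \o g).
  (* An integrable majorant of |g|: the Lipschitz bound from the origin, with the l1 norm in place
     of the Euclidean one so that integrability follows from that of the coordinates. *)
  pose b (x : borelRn R h) : R := `|g 0| + a * l1norm (x : 'cV[R]_h).
  have bi : mu.-integrable setT (EFin \o b).
    have li : mu.-integrable setT
        (EFin \o (fun x : borelRn R h => l1norm (x : 'cV[R]_h))).
      rewrite (_ : _ \o _ =
          fun x => (\sum_(i < h) `|((x : 'cV[R]_h) i 0)%:E|)%E); last first.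
        by apply/funext => x /=; rewrite sumEFin.
      by apply: integrable_sum => // i _; exact: integrable_abse (xi i).
    have ci : mu.-integrable setT (EFin \o (fun=> `|g 0| : R)).
      exact: finite_measure_integrable_cst.
    have ali : mu.-integrable setT
        (EFin \o (fun x : borelRn R h => a * l1norm (x : 'cV[R]_h))).
      exact: (integrableZl measurableT a li).
    exact: (integrableD measurableT ci ali).
  apply: le_integrable bi => //; first exact/measurable_EFinP.
  move=> x _; rewrite /= lee_fin.
  have l1 : 0 <= l1norm (x : 'cV[R]_h) by apply: sumr_ge0.
  have -> : `|b x| = b x by rewrite ger0_norm// addr_ge0// mulr_ge0.
  have := gl x 0; have := l2norm_le_l1norm (x : 'cV[R]_h).
  rewrite /l2dist subr0 => h1 h2.
  have h3 := ler_normD (g x - g 0) (g 0); rewrite subrK in h3.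
  by apply: (le_trans h3); rewrite addrC lerD2l (le_trans h2)// ler_wpM2l.
split=> //; set m := Rintegral _ _ _.
pose alpha (x : borelRn R h) := expR (g x - m).
(* [- m] is the mean of [- g], so [beta] has the shape required by [integral_expRB_ge1]. *)
pose beta (x : borelRn R h) := expR (- g x - - m).
have [A AE] : exists A, A = (\int[mu]_x (alpha x)%:E)%E by eexists.
have [B BE] : exists B, B = (\int[mu]_x (beta x)%:E)%E by eexists.
rewrite -[leLHS]AE.
have al0R x : 0 <= alpha x by exact: expR_ge0.
have be0R x : 0 <= beta x by exact: expR_ge0.
have al0 x : (0 <= (alpha x)%:E)%E by rewrite lee_fin expR_ge0.
have be0 x : (0 <= (beta x)%:E)%E by rewrite lee_fin expR_ge0.
have malpha : measurable_fun setT (fun x : borelRn R h => (alpha x)%:E).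
  exact: measurable_expRB.
have mbeta : measurable_fun setT (fun x : borelRn R h => (beta x)%:E).
  exact: (measurable_expRB _ (measurable_funN mg)).
have A0 : (0 <= A)%E by rewrite AE; exact: integral_ge0.
have B1 : (1 <= B)%E.
  rewrite BE; have := integral_expRB_ge1 (integrableN gi).
  suff -> : \int[mu]_y - g y = - m by [].
  rewrite /Rintegral; under eq_integral do rewrite EFinN.
  rewrite integralN//=; last exact: integrable_add_def gi.
  by rewrite fineN.
have B0 : (0 <= B)%E := le_trans lee01 B1.
pose z := mean_vector mu.
pose E (b : R) e (x : borelRn R h) : R :=
  expR (((signed_vector b e)^T *m ((x : 'cV[R]_h) - z)) 0 0).
(* The sub-Gaussian bound in a direction with entries a or -a; it depends on the direction only
   through its squared norm. *)
pose kappa := expR (a ^+ 2 * h%:R * tau ^+ 2 / 2).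
have E0 b e x : 0 <= E b e x by exact: expR_ge0.
have mE b e : measurable_fun setT (fun x => (E b e x)%:E).
  apply/measurable_EFinP; apply: (measurableT_comp (@measurable_expR R)).
  under eq_fun do rewrite !mxE.
  apply: measurable_sum => i; apply: measurable_funM => //.
  under eq_fun do rewrite !mxE.
  exact: measurable_funB (measurable_coord i) (measurable_cst _).
have Ek b e : b ^+ 2 = a ^+ 2 -> (\int[mu]_x (E b e x)%:E <= kappa%:E)%E.
  move=> ba; apply: le_trans (mgf (signed_vector b e)) _.
  by rewrite sqr_l2norm_signed ba.
have step1 x : ((2 ^+ h)%:E * (B * (alpha x)%:E + A * (beta x)%:E) <=
    \sum_(e : {ffun 'I_h -> bool}) (2 * kappa)%:E * (E a e x)%:E)%E.
  have -> : ((2 ^+ h)%:E * (B * (alpha x)%:E + A * (beta x)%:E) =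
      \int[mu]_y (2 ^+ h * (alpha x * beta y + beta x * alpha y))%:E)%E.
    under eq_integral do rewrite EFinM EFinD !EFinM.
    rewrite ge0_integral_lincomb ?exprn_ge0// -AE -BE.
    by rewrite [(B * _)%E]muleC [(A * _)%E]muleC.
  apply: (@le_trans _ _ (\int[mu]_y \sum_(e : {ffun 'I_h -> bool})
      (2 * E a e x)%:E * (E (- a) e y)%:E)%E).
    apply: ge0_le_integral => //.
    - by move=> y _; rewrite lee_fin mulr_ge0// addr_ge0// mulr_ge0.
    - apply/measurable_EFinP; apply: measurable_funM => //.
      apply: measurable_funD; apply: measurable_funM => //.
      + exact/measurable_EFinP.
      + exact/measurable_EFinP.
    - by apply: emeasurable_sum => e; exact: measurable_funeM.
    - move=> y _; under eq_bigr do rewrite -EFinM.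
      rewrite sumEFin lee_fin.
      have := @ch2_l2dist_signs a g x y z a0 gl.
      rewrite /ch2 opprB mulr_sumr /alpha /beta -!expRD.
      rewrite (_ : g x - m + (- g y - - m) = g x - g y); last by ring.
      rewrite (_ : - g x - - m + (g y - m) = g y - g x); last by ring.
      by move/le_trans; apply; apply: ler_sum => e _; rewrite mulrA.
  rewrite ge0_integral_sum//; last 2 first.
  - by move=> e; exact: measurable_funeM.
  - by move=> e y _; rewrite mule_ge0// lee_fin ?mulr_ge0.
  apply: lee_sum => e _; rewrite ge0_integralZl//; last 2 first.
  - by move=> y _; rewrite lee_fin.
  - by rewrite lee_fin mulr_ge0.
  have -> : ((2 * kappa)%:E * (E a e x)%:E = (2 * E a e x)%:E * kappa%:E)%E.
    by rewrite -!EFinM mulrAC.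
  apply: lee_wpmul2l; first by rewrite lee_fin mulr_ge0.
  by apply: Ek; rewrite sqrrN.
(* Integration in x turns the left side into 2^h times 2 A B; on the right the 2^h sign vectors each
   contribute at most 2 kappa^2. *)
have step2 : ((2 ^+ h)%:E * (A * B + A * B) <= (2 ^+ h * (kappa ^+ 2 *+ 2))%:E)%E.
  have -> : ((2 ^+ h)%:E * (A * B + A * B) =
      \int[mu]_x ((2 ^+ h)%:E * (B * (alpha x)%:E + A * (beta x)%:E)))%E.
    by rewrite ge0_integral_lincomb ?exprn_ge0// -AE -BE [(B * A)%E]muleC.
  apply: (@le_trans _ _ (\int[mu]_x
      \sum_(e : {ffun 'I_h -> bool}) (2 * kappa)%:E * (E a e x)%:E)%E).
    apply: ge0_le_integral => //.
    - by move=> x _; rewrite mule_ge0// adde_ge0// mule_ge0// lee_fin expR_ge0.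
    - by apply: measurable_funeM; apply: emeasurable_funD; exact: measurable_funeM.
    - by apply: emeasurable_sum => e; exact: measurable_funeM.
  rewrite ge0_integral_sum//; last 2 first.
  - by move=> e; exact: measurable_funeM.
  - by move=> e y _; rewrite mule_ge0// lee_fin ?mulr_ge0// expR_ge0.
  apply: (@le_trans _ _ (\sum_(e : {ffun 'I_h -> bool}) (2 * kappa * kappa)%:E)%E).
    apply: lee_sum => e _; rewrite ge0_integralZl//; last 2 first.
    - by move=> y _; rewrite lee_fin.
    - by rewrite lee_fin mulr_ge0// expR_ge0.
    rewrite [leRHS]EFinM; apply: lee_wpmul2l.
      by rewrite lee_fin mulr_ge0// expR_ge0.
    exact: Ek.
  rewrite sumEFin lee_fin sumr_const card_ffun card_bool card_ord.
  by rewrite -[leLHS]mulr_natl natrX -mulrA expr2 mulr2n mulrDl mul1r.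
(* The finite bound just obtained also excludes an infinite product, so 2^h can be cancelled. *)
have AB : (A * B <= (kappa ^+ 2)%:E)%E.
  have : (0 <= A * B)%E by exact: mule_ge0.
  move: (A * B)%E step2 => [r||]//=; rewrite ?lee_fin ?EFinN.
    by rewrite ler_pM2l ?exprn_gt0// => r1 _; lra.
  by rewrite addye// gt0_muley ?lte_fin ?exprn_gt0// leye_eq.
apply: (@le_trans _ _ (A * B)%E); first by rewrite -[leLHS]mule1 lee_wpmul2l.
apply: le_trans AB _; rewrite lee_fin /kappa expr2 -expRD ler_expR.
rewrite -splitr -mulrA ler_wpM2l ?sqr_ge0// ler_wpM2l//.
by rewrite lerXn2r// nnegrE ltW// (lt_le_trans tau0).
Qed.

End Euclidean.

(** * Symmetrization *)

Section SupAbs.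
Context {R : realType} {I : Type} (F : set I).
Implicit Types phi psi : I -> R.

Definition bounded_on phi : Prop := exists B, forall f, F f -> `|phi f| <= B.

(** Real valued, so that Lipschitz bounds apply to it; [ereal_sup_abs] relates it to the extended
    suprema of the statement. *)
Definition sup_abs phi : R := sup [set `|phi f| | f in F].

Lemma bounded_onD phi psi :
  bounded_on phi -> bounded_on psi -> bounded_on (fun f => phi f + psi f).
Proof.
move=> [B phiB] [B' psiB]; exists (B + B') => f Ff.
by rewrite (le_trans (ler_normD _ _))// lerD ?phiB ?psiB.
Qed.

Lemma bounded_onZ (a : R) phi :
  bounded_on phi -> bounded_on (fun f => a * phi f).
Proof.
move=> [B phiB]; exists (`|a| * B) => f Ff.
by rewrite normrM ler_wpM2l ?phiB.
Qed.

Lemma bounded_onN phi : bounded_on phi -> bounded_on (fun f => - phi f).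
Proof. by move=> [B phiB]; exists B => f Ff; rewrite normrN phiB. Qed.

Lemma bounded_on_sum n (phi : 'I_n -> I -> R) :
  (forall i, bounded_on (phi i)) -> bounded_on (fun f => \sum_(i < n) phi i f).
Proof.
move=> /(_ _)/cid-/all_sig[B phiB]; exists (\sum_(i < n) B i) => f Ff.
by rewrite (le_trans (ler_norm_sum _ _ _))// ler_sum// => i _; exact: phiB.
Qed.

Lemma le_sup_abs phi f : bounded_on phi -> F f -> `|phi f| <= sup_abs phi.
Proof.
move=> [B phiB] Ff; apply: ub_le_sup; last by exists f.
by exists B => _ [g Fg <-]; exact: phiB.
Qed.

Lemma sup_abs_le phi b :
  F !=set0 -> (forall f, F f -> `|phi f| <= b) -> sup_abs phi <= b.
Proof.
move=> [f0 Ff0] phib; apply: ge_sup; first by exists `|phi f0|, f0.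
by move=> _ [f Ff <-]; exact: phib.
Qed.

Lemma sup_abs_ge0 phi : bounded_on phi -> F !=set0 -> 0 <= sup_abs phi.
Proof. by move=> bphi [f Ff]; apply: le_trans (le_sup_abs bphi Ff). Qed.

Lemma ereal_sup_abs phi :
  F !=set0 -> bounded_on phi ->
  ereal_sup [set (`|phi f|)%:E | f in F] = (sup_abs phi)%:E.
Proof.
move=> [f0 Ff0] [B phiB]; rewrite -ereal_sup_EFin.
- by rewrite image_comp.
- by exists B => _ [f Ff <-]; exact: phiB.
- by exists `|phi f0|, f0.
Qed.

End SupAbs.

(** This passes a Lipschitz constant common to a class on to the supremum over it, and with it
    measurability and integrability. *)
Lemma sup_abs_dist (R : realType) I (F : set I) (phi psi : I -> R) b :
  F !=set0 -> bounded_on F phi -> bounded_on F psi ->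
  (forall f, F f -> `|phi f - psi f| <= b) ->
  `|sup_abs F phi - sup_abs F psi| <= b.
Proof.
have half u w : F !=set0 -> bounded_on F w ->
    (forall f, F f -> `|u f - w f| <= b) -> sup_abs F u <= sup_abs F w + b.
  move=> F0 bw uw; apply: sup_abs_le => // f Ff.
  rewrite -[u f](subrK (w f)) addrC (le_trans (ler_normD _ _))// lerD//.
    exact: le_sup_abs.
  exact: uw.
move=> F0 bphi bpsi phipsi.
have h1 := half _ _ F0 bpsi phipsi.
have h2 : sup_abs F psi <= sup_abs F phi + b.
  by apply: half => // f Ff; rewrite distrC phipsi.
by rewrite ler_norml; lra.
Qed.

(** * Exchanging coordinates of two independent samples *)

Section Swap.
Context {R : realType} dT (T : measurableType dT) (mu : probability T R).

Definition tuple_pick U n (e : 'I_n -> bool) (x y : n.-tuple U) : n.-tuple U :=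
  [tuple if e i then tnth y i else tnth x i | i < n].

Lemma tuple_pick_cons n (e : 'I_n.+1 -> bool) (p q : T * n.-tuple T) :
  tuple_pick e (tuple_cons p) (tuple_cons q) =
  tuple_cons (if e ord0 then q.1 else p.1,
              tuple_pick (fun i => e (lift ord0 i)) p.2 q.2).
Proof.
apply: eq_from_tnth => i; rewrite tnth_mktuple.
have [j ->|->] := unliftP ord0 i; last by case: (e ord0).
by rewrite !tnthS tnth_mktuple.
Qed.

Lemma measurable_tuple_pick n (e : 'I_n -> bool) :
  measurable_fun setT (fun q : n.-tuple T * n.-tuple T => tuple_pick e q.1 q.2).
Proof.
apply/measurable_fun_tnthP => i.
rewrite (_ : _ \o _ = fun q => if e i then tnth q.2 i else tnth q.1 i); last first.
  by apply/funext => q /=; rewrite tnth_mktuple.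
case: (e i).
  exact: (measurableT_comp (measurable_tnth i) measurable_snd).
exact: (measurableT_comp (measurable_tnth i) measurable_fst).
Qed.

Lemma measurable_fubini2 d1 d2 d3 (X : measurableType d1) (Y : measurableType d2)
    (Z : measurableType d3) (P : probability Y R) (Q : probability Z R)
    (f : (X * Y) * Z -> \bar R) :
  measurable_fun setT f -> (forall r, 0 <= f r)%E ->
  measurable_fun setT (fun x => \int[P]_y \int[Q]_z f ((x, y), z))%E.
Proof.
move=> mf f0.
pose g (r : X * Y) := (\int[Q]_z f (r, z))%E.
have mg : measurable_fun setT g by exact: (measurable_fun_fubini_tonelli_F f).
apply: (measurable_fun_fubini_tonelli_F g) => // r.
exact: integral_ge0.
Qed.

(** Tonelli's theorem brings the first components of the two samples to the outside, next to each
    other, where they can be exchanged independently of the tails. *)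
Lemma iterated_integral_pair d1 d2 d3 (X : measurableType d1)
    (Y : measurableType d2) (Z : measurableType d3) (P1 : probability X R)
    (P2 : probability Y R) (P : probability Z R) (k : X * Y -> Z)
    (Phi : Z * Z -> \bar R) :
  measurable_fun setT k ->
  (forall f : Z -> \bar R, measurable_fun setT f -> (forall z, 0 <= f z)%E ->
    \int[P]_z f z = \int[P1]_a \int[P2]_s f (k (a, s)))%E ->
  measurable_fun setT Phi -> (forall r, 0 <= Phi r)%E ->
  (\int[P]_z \int[P]_w Phi (z, w) =
   \int[P1]_a \int[P1]_b \int[P2]_s \int[P2]_t Phi (k (a, s), k (b, t)))%E.
Proof.
move=> mk kP mPhi Phi0.
rewrite (kP (fun z => \int[P]_w Phi (z, w))%E); last 2 first.
- exact: (measurable_fun_fubini_tonelli_F Phi).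
- by move=> z; exact: integral_ge0.
apply: eq_integral => a _.
transitivity (\int[P2]_s \int[P1]_b \int[P2]_t Phi (k (a, s), k (b, t)))%E.
  apply: eq_integral => s _; apply: kP => //.
  by apply: (measurableT_comp mPhi); exact: measurable_pair1.
pose g (r : Y * X) := (\int[P2]_t Phi (k (a, r.1), k (r.2, t)))%E.
have mg : measurable_fun setT g.
  apply: (measurable_fun_fubini_tonelli_F
    (fun r : (Y * X) * Y => Phi (k (a, r.1.1), k (r.1.2, r.2)))) => //.
  apply: (measurableT_comp mPhi); apply: measurable_fun_pair;
    apply: (measurableT_comp mk); apply: measurable_fun_pair => //.
  - exact: (measurableT_comp measurable_fst measurable_fst).
  - exact: (measurableT_comp measurable_snd measurable_fst).
by apply: (fubini_tonelli g) => // r; exact: integral_ge0.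
Qed.

Lemma integral_iid_power_iter n (f : n.+1.-tuple T -> \bar R) :
  measurable_fun setT f -> (forall z, 0 <= f z)%E ->
  (\int[iid_power mu n.+1]_z f z =
   \int[mu]_a \int[iid_power mu n]_s f (tuple_cons (a, s)))%E.
Proof.
move=> mf f0; rewrite ge0_integral_iid_powerS// fubini_tonelli1//.
exact: (measurableT_comp mf (@measurable_tuple_cons _ T n)).
Qed.

(** Induction on the length: exchanging the two heads amounts to swapping the two outer integrals,
    and the tails fall under the induction hypothesis. *)
Lemma integral_tuple_pick n (e : 'I_n -> bool)
    (Phi : n.-tuple T * n.-tuple T -> \bar R) :
  measurable_fun setT Phi -> (forall q, 0 <= Phi q)%E ->
  (\int[iid_power mu n]_x \int[iid_power mu n]_y Phi (x, y) =
   \int[iid_power mu n]_x \int[iid_power mu n]_y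
     Phi (tuple_pick e x y, tuple_pick e y x))%E.
Proof.
elim: n e Phi => [|n IHn] e Phi mPhi Phi0.
  apply: eq_integral => x _; apply: eq_integral => y _.
  rewrite (tuple0 (tuple_pick e x y)) (tuple0 (tuple_pick e y x)).
  by rewrite (tuple0 x) (tuple0 y).
pose Psi q := Phi (tuple_pick e q.1 q.2, tuple_pick e q.2 q.1).
have mPsi : measurable_fun setT Psi.
  apply: (measurableT_comp mPhi); apply: measurable_fun_pair.
    exact: measurable_tuple_pick.
  exact: (measurableT_comp (measurable_tuple_pick e)
    (measurable_fun_pair measurable_snd measurable_fst)).
have mcons := @measurable_tuple_cons _ T n.
have iter := @integral_iid_power_iter n.
rewrite (iterated_integral_pair mcons iter mPhi Phi0).
rewrite (iterated_integral_pair mcons iter mPsi (fun=> Phi0 _)).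
pose e' i := e (lift ord0 i).
pose K (p : T * T) := (\int[iid_power mu n]_s \int[iid_power mu n]_t
  Phi (tuple_cons (p.1, s), tuple_cons (p.2, t)))%E.
have mPhic : measurable_fun setT (fun r : ((T * T) * n.-tuple T) * n.-tuple T =>
      Phi (tuple_cons (r.1.1.1, r.1.2), tuple_cons (r.1.1.2, r.2))).
  apply: (measurableT_comp mPhi); apply: measurable_fun_pair;
    apply: (measurableT_comp mcons); apply: measurable_fun_pair => //.
  - exact: (measurableT_comp measurable_fst
      (measurableT_comp measurable_fst measurable_fst)).
  - exact: (measurableT_comp measurable_snd measurable_fst).
  - exact: (measurableT_comp measurable_snd
      (measurableT_comp measurable_fst measurable_fst)).
have mK : measurable_fun setT K.
  exact: (measurable_fubini2 (iid_power mu n) (iid_power mu n) mPhic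
    (fun=> Phi0 _)).
have K0 p : (0 <= K p)%E by do 2 apply: integral_ge0 => ? _.
(* With the heads frozen in their possibly exchanged order, the induction hypothesis removes the
   exchanges in the tails. *)
have KE a b : (\int[iid_power mu n]_s \int[iid_power mu n]_t
    Psi (tuple_cons (a, s), tuple_cons (b, t)) =
    K (if e ord0 then (b, a) else (a, b)))%E.
  pose p := if e ord0 then (b, a) else (a, b).
  pose f (q : n.-tuple T * n.-tuple T) :=
    Phi (tuple_cons (p.1, q.1), tuple_cons (p.2, q.2)).
  have mf : measurable_fun setT f.
    apply: (measurableT_comp mPhi); apply: measurable_fun_pair;
      apply: (measurableT_comp mcons); exact: measurable_fun_pair.
  rewrite [RHS](IHn e' f mf (fun=> Phi0 _)).
  apply: eq_integral => s _; apply: eq_integral => t _.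
  by rewrite /Psi /f /p !tuple_pick_cons; case: (e ord0).
transitivity (\int[mu]_a \int[mu]_b K (a, b))%E; first by [].
transitivity (\int[mu]_a \int[mu]_b K (if e ord0 then (b, a) else (a, b)))%E.
  case: (e ord0); last by [].
  exact: (fubini_tonelli K mK K0).
by apply: eq_integral => a _; apply: eq_integral => b _; rewrite KE.
Qed.

End Swap.

(** * Empirical means and marginals of the sample law *)

Section EmpiricalMean.
Context {R : realType} dT (T : measurableType dT).

Definition emp n (x : n.-tuple T) (f : T -> R) : R :=
  n%:R^-1 * \sum_(i < n) f (tnth x i).

Lemma ge0_integral_empirical n (x : n.-tuple T) (f : T -> \bar R) :
  measurable_fun setT f -> (forall y, 0 <= f y)%E ->
  (\int[empirical_measure R x]_y f y =
   (n%:R^-1)%:E * \sum_(i < n) f (tnth x i))%E.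
Proof.
move=> mf f0; rewrite ge0_integral_mscale// ge0_integral_measure_sum//=.
congr (_ * _)%E; apply: eq_bigr => i _.
by rewrite integral_dirac// diracT mul1e (tnth_nth point).
Qed.

Lemma integral_empirical n (x : n.-tuple T) (f : T -> R) :
  measurable_fun setT f ->
  (\int[empirical_measure R x]_y (f y)%:E = (emp x f)%:E)%E.
Proof.
move=> mf; rewrite integralE -/(EFin \o f) funerpos funerneg.
rewrite !ge0_integral_empirical; last 4 first.
- by apply/measurable_EFinP; exact: measurable_funrneg.
- by move=> y; rewrite lee_fin funrneg_ge0.
- by apply/measurable_EFinP; exact: measurable_funrpos.
- by move=> y; rewrite lee_fin funrpos_ge0.
rewrite !sumEFin -!EFinM -EFinB -mulrBr -sumrB; congr (_ * _)%:E.
by apply: eq_bigr => i _; rewrite -[in RHS](funrposBneg f).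
Qed.

(** The i-th marginal is [mu]: apply [iid_power_box] to a box whose sides other than the i-th are
    the whole space. *)
Lemma integral_iid_power_tnth n (i : 'I_n) (mu : probability T R) (f : T -> R) :
  measurable_fun setT f ->
  (iid_power mu n).-integrable setT (fun x => (f (tnth x i))%:E) ->
  \int[iid_power mu n]_x f (tnth x i) = \int[mu]_y f y.
Proof.
move=> mf fi; rewrite /Rintegral; congr fine.
have mi := @measurable_tnth _ T n i.
transitivity (\int[pushforward (iid_power mu n) (fun x => tnth x i)]_y (f y)%:E)%E.
  by rewrite integral_pushforward//; exact/measurable_EFinP.
apply: eq_measure_integral => A mA _; rewrite /pushforward.
pose B j := if j == i then A else setT.
have mB j : measurable (B j) by rewrite /B; case: ifP.
have := iid_power_box mu mB.
rewrite (bigD1 i)//= big1 => [|j /negPf ji]; last by rewrite /B ji probability_setT.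
rewrite /B eqxx mule1 => <-; congr (iid_power mu n _).
apply/seteqP; split=> [x Ax j|x /(_ i)]; last by rewrite eqxx.
by case: eqP => // ->.
Qed.

End EmpiricalMean.

(** * Uniform deviation of one sample: symmetrization and Laplace bound *)

Section Deviation.
Context {R : realType} dT (T : measurableType dT) (c : T -> T -> R).
Context (F : set (T -> R)) (C v : R).
Context (sc : separable_cost c) (F0 : F !=set0) (C0 : 0 <= C).
Context (lipF : forall f, F f -> lip c C f).
Context (bF : forall x, bounded_on F (fun f => f x)).

Lemma measurable_lip_class f : F f -> measurable_fun setT f.
Proof. by move=> /lipF; exact: lip_measurable. Qed.

Lemma divr_ge0_natr n : 0 <= C / n%:R.
Proof. by rewrite divr_ge0. Qed.

(** Weights of modulus at most 1 cover both plain empirical means and Rademacher sums. *)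
Lemma weighted_mean_lip n (w : 'I_n -> R) f :
  (forall i, `|w i| <= 1) -> F f ->
  lip (@tuple_cost R T c n) (C / n%:R)
    (fun x => n%:R^-1 * \sum_(i < n) w i * f (tnth x i)).
Proof.
move=> w1 Ff x y; rewrite -mulrBr -sumrB normrM ger0_norm ?invr_ge0//.
rewrite [C / _]mulrC -mulrA ler_wpM2l ?invr_ge0// mulr_sumr.
apply: le_trans (ler_norm_sum _ _ _) _; apply: ler_sum => i _.
rewrite -mulrBr normrM; apply: le_trans (lipF Ff _ _).
by rewrite ler_piMl.
Qed.

Lemma emp_lip n f :
  F f -> lip (@tuple_cost R T c n) (C / n%:R) (fun x => emp x f).
Proof.
move=> Ff x y.
have := @weighted_mean_lip n (fun=> 1) f _ Ff x y.
under eq_bigr do rewrite mul1r.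
under [\sum_(i < n) 1 * f (tnth y i)]eq_bigr do rewrite mul1r.
by apply => _; rewrite normr1.
Qed.

Lemma bounded_weighted_mean n (w : 'I_n -> R) (x : n.-tuple T) :
  bounded_on F (fun f => n%:R^-1 * \sum_(i < n) w i * f (tnth x i)).
Proof.
by apply: bounded_onZ; apply: bounded_on_sum => i; exact: bounded_onZ.
Qed.

Lemma bounded_emp n (x : n.-tuple T) : bounded_on F (emp x).
Proof. by apply: bounded_onZ; exact: bounded_on_sum. Qed.

Definition signed_sup n (e : {ffun 'I_n -> bool}) (x : n.-tuple T) : R :=
  sup_abs F (fun f => n%:R^-1 * \sum_(i < n) (-1) ^+ e i * f (tnth x i)).

Lemma signed_sup_lip n (e : {ffun 'I_n -> bool}) :
  lip (@tuple_cost R T c n) (C / n%:R) (signed_sup e).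
Proof.
move=> x y; apply: sup_abs_dist => //.
- exact: bounded_weighted_mean.
- exact: bounded_weighted_mean.
- move=> f Ff.
  apply: (weighted_mean_lip (w := fun i => (-1) ^+ e i)) => // i.
  by rewrite normrX normrN1 expr1n.
Qed.

Context (mu : probability T R) (L : laplace_bounded c mu v).

Lemma integrable_lip_class f : F f -> mu.-integrable setT (EFin \o f).
Proof. by move=> /lipF fl; have [] := L C0 fl. Qed.

(** The envelope sup_f |f x| is finite and C-Lipschitz, hence integrable, and its mean bounds all
    the means at once. *)
Lemma bounded_mean : bounded_on F (fun f => \int[mu]_y f y).
Proof.
pose b x := sup_abs F (fun f => f x).
have bl : lip c C b.
  by move=> x y; apply: sup_abs_dist => // f Ff; exact: lipF.
have [bi _] := L C0 bl.
exists (\int[mu]_y b y) => f Ff.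
apply: (le_trans (le_normr_Rintegral measurableT (integrable_lip_class Ff))).
apply: le_Rintegral => //; first exact: integrable_abse (integrable_lip_class Ff).
by move=> x _; exact: le_sup_abs (bF x) Ff.
Qed.

Definition deviation n (x : n.-tuple T) : R :=
  sup_abs F (fun f => \int[mu]_y f y - emp x f).

Lemma bounded_deviation n (x : n.-tuple T) :
  bounded_on F (fun f => \int[mu]_y f y - emp x f).
Proof.
by apply: bounded_onD; [exact: bounded_mean|apply: bounded_onN; exact: bounded_emp].
Qed.

Lemma deviation_lip n : lip (@tuple_cost R T c n) (C / n%:R) (@deviation n).
Proof.
move=> x y; apply: sup_abs_dist => //; [exact: bounded_deviation..|].
move=> f Ff; rewrite opprB addrC addrA subrK distrC.
exact: emp_lip.
Qed.

Lemma integral_emp n f : (0 < n)%N -> F f ->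
  \int[iid_power mu n]_x emp x f = \int[mu]_y f y.
Proof.
move=> n0 Ff.
have ti i : (iid_power mu n).-integrable setT (fun x => (f (tnth x i))%:E).
  have fl : lip (@tuple_cost R T c n) C (fun x => f (tnth x i)).
    move=> x y; apply: le_trans (lipF Ff _ _) _; rewrite ler_wpM2l//.
    have [c0 _ _ _] := sc.
    by rewrite /tuple_cost (bigD1 i)//= lerDl sumr_ge0.
  by have [] := laplace_iid (n := n) sc L C0 fl.
have si : (iid_power mu n).-integrable setT
    (EFin \o (fun x => \sum_(i < n) f (tnth x i))).
  rewrite (_ : _ \o _ = fun x => (\sum_(i < n) (f (tnth x i))%:E)%E).
    exact: integrable_sum.
  by apply/funext => x; rewrite /= sumEFin.
have mean i : (\int[iid_power mu n]_x (f (tnth x i))%:E = (\int[mu]_y f y)%:E)%E.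
  rewrite -(integral_iid_power_tnth (measurable_lip_class Ff) (ti i)).
  by rewrite /Rintegral fineK//; exact: (integrable_fin_num measurableT (ti i)).
rewrite RintegralZl// /Rintegral.
under eq_integral do rewrite -sumEFin.
rewrite integral_sum// (eq_bigr _ (fun i _ => mean i)).
rewrite sumEFin /= sumr_const card_ord -[X in _ * X]mulr_natl mulrA mulVf ?mul1r//.
by rewrite pnatr_eq0 -lt0n.
Qed.

Let sct n := separable_tuple n sc.

(** The second sample is the ghost sample, standing in for the exact mean in [deviation]. *)
Definition ghost_sup n (q : n.-tuple T * n.-tuple T) : R :=
  sup_abs F (fun f => emp q.2 f - emp q.1 f).

Lemma bounded_ghost n (q : n.-tuple T * n.-tuple T) :
  bounded_on F (fun f => emp q.2 f - emp q.1 f).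
Proof.
by apply: bounded_onD; [exact: bounded_emp|apply: bounded_onN; exact: bounded_emp].
Qed.

Lemma ghost_sup_lip n :
  lip (prod_cost (@tuple_cost R T c n) (@tuple_cost R T c n)) (C / n%:R)
    (@ghost_sup n).
Proof.
move=> x y; apply: sup_abs_dist => //; [exact: bounded_ghost..|].
move=> f Ff; rewrite mulrDr.
rewrite (_ : _ - _ = (emp y.1 f - emp x.1 f) + (emp x.2 f - emp y.2 f));
  last by ring.
apply: le_trans (ler_normD _ _) _; rewrite lerD//; last exact: emp_lip.
by rewrite distrC; exact: emp_lip.
Qed.

(* Exchanging the [i]-th coordinates of the sample and of its independent copy
   when [e i] holds multiplies [f (y i) - f (x i)] by [(-1) ^+ e i]. *)
Lemma ghost_sup_pick n (e : {ffun 'I_n -> bool}) (q : n.-tuple T * n.-tuple T) :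
  ghost_sup (tuple_pick e q.1 q.2, tuple_pick e q.2 q.1) <=
  signed_sup e q.1 + signed_sup e q.2.
Proof.
apply: sup_abs_le => // f Ff.
have -> : emp (tuple_pick e q.2 q.1) f - emp (tuple_pick e q.1 q.2) f =
    - (n%:R^-1 * \sum_(i < n) (-1) ^+ e i * f (tnth q.1 i)) +
    n%:R^-1 * \sum_(i < n) (-1) ^+ e i * f (tnth q.2 i).
  rewrite [RHS]addrC /emp -!mulrBr -!sumrB; congr (_ * _); apply: eq_bigr => i _.
  rewrite !tnth_mktuple; case: (e i); rewrite ?expr1 ?expr0; ring.
apply: le_trans (ler_normD _ _) _; rewrite normrN.
by apply: lerD;
  apply: (le_sup_abs (bounded_weighted_mean (fun i => (-1) ^+ e i) _) Ff).
Qed.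

Lemma signed_sup_ge0 n (e : {ffun 'I_n -> bool}) x : 0 <= signed_sup e x.
Proof. by apply: sup_abs_ge0 => //; exact: bounded_weighted_mean. Qed.

Lemma measurable_signed_sup n (e : {ffun 'I_n -> bool}) :
  measurable_fun setT (signed_sup e).
Proof. exact: lip_measurable (sct n) (divr_ge0_natr n) (signed_sup_lip e). Qed.

Lemma measurable_deviation n : measurable_fun setT (@deviation n).
Proof. exact: lip_measurable (sct n) (divr_ge0_natr n) (@deviation_lip n). Qed.

Lemma deviation_ge0 n (x : n.-tuple T) : 0 <= deviation x.
Proof. by apply: sup_abs_ge0 => //; exact: bounded_deviation. Qed.

(** Valid for each fixed sign vector: a ghost sample replaces the mean, the coordinates selected by
    [e] are exchanged without changing the law, and the triangle inequality separates the two
    samples, whence the factor 2. *)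
Lemma integral_deviation_signed n (e : {ffun 'I_n -> bool}) : (0 < n)%N ->
  (\int[iid_power mu n]_x (deviation x)%:E <=
   2%:E * \int[iid_power mu n]_x (signed_sup e x)%:E)%E.
Proof.
move=> n0; have Cn := divr_ge0_natr n; have Ln := laplace_iid (n := n) sc L.
have [tc0 tcxx _ _] := sct n.
have mghost : measurable_fun setT (fun q => (@ghost_sup n q)%:E).
  apply/measurable_EFinP.
  exact: lip_measurable (separable_prod (sct n) (sct n)) Cn (@ghost_sup_lip n).
have ghost0 q : (0 <= (@ghost_sup n q)%:E)%E.
  by rewrite lee_fin sup_abs_ge0//; exact: bounded_ghost.
(* Jensen's inequality: the mean of f is the mean of [emp y f] over the ghost sample y, and a
   supremum of integrals is at most the integral of the supremum. *)
have dev_ghost x :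
    ((deviation x)%:E <= \int[iid_power mu n]_y (ghost_sup (x, y))%:E)%E.
  have gi : (iid_power mu n).-integrable setT
      (EFin \o (fun y => ghost_sup (x, y))).
    have gl : lip (@tuple_cost R T c n) (C / n%:R) (fun y => ghost_sup (x, y)).
      move=> y y'; apply: le_trans (ghost_sup_lip _ _) _.
      by rewrite /prod_cost tcxx add0r.
    by have [] := Ln _ _ Cn gl.
  suff : deviation x <= \int[iid_power mu n]_y ghost_sup (x, y).
    by rewrite -lee_fin => /le_trans; apply; rewrite /Rintegral fineK//;
      exact: (integrable_fin_num measurableT gi).
  apply: sup_abs_le => // f Ff.
  have ei : (iid_power mu n).-integrable setT (EFin \o (fun y => emp y f)).
    by have [] := Ln _ _ Cn (emp_lip Ff).
  have ci : (iid_power mu n).-integrable setT (EFin \o (fun=> emp x f)).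
    exact: finite_measure_integrable_cst.
  have -> : \int[mu]_y f y - emp x f = \int[iid_power mu n]_y (emp y f - emp x f).
    rewrite RintegralB// integral_emp// Rintegral_cst//.
    by rewrite [fine _](congr1 fine (probability_setT (iid_power mu n))) mulr1.
  have di : (iid_power mu n).-integrable setT (EFin \o (fun y => emp y f - emp x f)).
    exact: (integrableB measurableT ei ci).
  apply: (le_trans (le_normr_Rintegral measurableT di)).
  apply: le_Rintegral => //; first exact: integrable_abse di.
  by move=> y _; apply: (le_sup_abs (bounded_ghost (x, y)) Ff).
have msg : measurable_fun setT (fun x => (signed_sup e x)%:E).
  by apply/measurable_EFinP; exact: measurable_signed_sup.
have sg0 x : (0 <= (signed_sup e x)%:E)%E by rewrite lee_fin signed_sup_ge0.
pose ghost q := (@ghost_sup n q)%:E.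
pose s x := (signed_sup e x)%:E.
have s0 x : (0 <= s x)%E by exact: sg0.
have ms : measurable_fun setT s by exact: msg.
apply: (@le_trans _ _
  (\int[iid_power mu n]_x \int[iid_power mu n]_y ghost (x, y))%E).
  apply: ge0_le_integral => //.
  - by move=> x _; rewrite lee_fin deviation_ge0.
  - by apply/measurable_EFinP; exact: measurable_deviation.
  - exact: (measurable_fun_fubini_tonelli_F ghost).
rewrite (integral_tuple_pick mu e mghost ghost0).
have mpick : measurable_fun setT (fun q : n.-tuple T * n.-tuple T =>
    (@ghost_sup n (tuple_pick e q.1 q.2, tuple_pick e q.2 q.1))%:E).
  apply: (measurableT_comp mghost); apply: measurable_fun_pair.
    exact: measurable_tuple_pick.
  exact: (measurableT_comp (measurable_tuple_pick e)
    (measurable_fun_pair measurable_snd measurable_fst)).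
have PT := probability_setT (iid_power mu n).
apply: (@le_trans _ _ (\int[iid_power mu n]_x (s x + \int[iid_power mu n]_y s y))%E).
  apply: ge0_le_integral => //.
  - by move=> x _; exact: integral_ge0.
  - exact: (measurable_fun_fubini_tonelli_F (fun q : n.-tuple T * n.-tuple T =>
      (@ghost_sup n (tuple_pick e q.1 q.2, tuple_pick e q.2 q.1))%:E)).
  - by apply: emeasurable_funD.
  - move=> x _.
    have -> : (s x + \int[iid_power mu n]_y s y =
        \int[iid_power mu n]_y (cst (s x) y + s y))%E.
      rewrite ge0_integralD//; last by move=> y _; exact: s0.
      by rewrite integral_cst// [X in (_ * X + _)%E]PT mule1.
    apply: ge0_le_integral => //.
    + exact: (measurableT_comp mpick (measurable_pair1 x)).
    + exact: emeasurable_funD.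
    + by move=> y _; rewrite lee_fin (ghost_sup_pick e (x, y)).
rewrite ge0_integralD//; last by move=> x _; exact: integral_ge0.
by rewrite integral_cst// [X in (_ * X)%E]PT mule1 -mule2n mule_natl.
Qed.

Lemma integral_deviation_rademacher n : (0 < n)%N ->
  (\int[iid_power mu n]_x (deviation x)%:E <=
   2%:E * rademacher_complexity n F mu)%E.
Proof.
move=> n0.
have p0 : 0 < (2 ^ n)%:R :> R by rewrite ltr0n expn_gt0.
have -> : rademacher_complexity n F mu = (((2 ^ n)%:R^-1)%:E *
    \sum_(e : {ffun 'I_n -> bool})
      \int[iid_power mu n]_x (signed_sup e x)%:E)%E.
  rewrite /rademacher_complexity -ge0_integral_sum//; last 2 first.
  - by move=> e; apply/measurable_EFinP; exact: measurable_signed_sup.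
  - by move=> e x _; rewrite lee_fin signed_sup_ge0.
  rewrite -ge0_integralZl//; last 2 first.
  - apply: emeasurable_sum => e; apply/measurable_EFinP.
    exact: measurable_signed_sup.
  - by move=> x _; apply: sume_ge0 => e _; rewrite lee_fin signed_sup_ge0.
  apply: eq_integral => x _; congr (_ * _)%E; apply: eq_bigr => e _.
  by rewrite ereal_sup_abs//; exact: bounded_weighted_mean.
rewrite muleCA ge0_sume_distrr; last first.
  by move=> e _; apply: integral_ge0 => x _; rewrite lee_fin signed_sup_ge0.
set D := (X in (X <= _)%E).
apply: (@le_trans _ _ (((2 ^ n)%:R^-1)%:E *
    \sum_(e : {ffun 'I_n -> bool}) D)%E); last first.
  apply: lee_wpmul2l; first by rewrite lee_fin invr_ge0 ltW.
  by apply: lee_sum => e _; exact: integral_deviation_signed.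
rewrite sumr_const card_ffun card_bool card_ord.
by rewrite -[X in (_ * X)%E]mule_natl muleA -EFinM mulVf ?gt_eqF// mul1e.
Qed.

(** The function lambda * [deviation] has Lipschitz constant lambda C/n, and n coordinates multiply
    v by n: (lambda C/n)^2 n v = lambda^2 C^2 v/n. *)
Lemma laplace_deviation n (lambda : R) : (0 < n)%N -> 0 <= lambda ->
  (\int[iid_power mu n]_x
    (expR (lambda * (deviation x - \int[iid_power mu n]_y deviation y)))%:E <=
   (expR (lambda ^+ 2 * (C ^+ 2 * v / n%:R)))%:E)%E.
Proof.
move=> n0 l0; have nn0 : n%:R != 0 :> R by rewrite pnatr_eq0 -lt0n.
have Ln := laplace_iid (n := n) sc L.
have Cn := divr_ge0_natr n.
have [di _] := Ln _ _ Cn (@deviation_lip n).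
have [_] := Ln _ _ (mulr_ge0 l0 Cn) (lipZ l0 (@deviation_lip n)).
rewrite RintegralZl//; under eq_integral do rewrite -mulrBr.
by move=> /le_trans; apply; rewrite lee_fin ler_expR le_eqVlt; apply/orP; left;
  apply/eqP; field.
Qed.

End Deviation.

(** * Concentration for two samples *)

Section TwoSamples.
Context {R : realType} dT (T : measurableType dT) (c : T -> T -> R).
Context (F : set (T -> R)) (C v : R).
Context (sc : separable_cost c) (F0 : F !=set0) (C0 : 0 <= C).
Context (lipF : forall f, F f -> lip c C f).
Context (bF : forall x, bounded_on F (fun f => f x)).
Context (mu nu : probability T R).
Context (Lmu : laplace_bounded c mu v) (Lnu : laplace_bounded c nu v).

Lemma F_distanceE (m1 m2 : {measure set T -> \bar R}) (phi psi : (T -> R) -> R) :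
  (forall f, F f -> \int[m1]_x (f x)%:E = (phi f)%:E)%E ->
  (forall f, F f -> \int[m2]_x (f x)%:E = (psi f)%:E)%E ->
  bounded_on F phi -> bounded_on F psi ->
  F_distance F m1 m2 = (sup_abs F (fun f => phi f - psi f))%:E.
Proof.
move=> m1E m2E bphi bpsi; rewrite -ereal_sup_abs//; last first.
  by apply: bounded_onD => //; exact: bounded_onN.
congr ereal_sup; apply/seteqP.
by split=> _ [f Ff <-]; exists f => //; rewrite m1E// m2E.
Qed.

Lemma integral_lip_class (P : probability T R) f :
  laplace_bounded c P v -> F f ->
  (\int[P]_x (f x)%:E = (\int[P]_x f x)%:E)%E.
Proof.
move=> LP /lipF fl; have [fi _] := LP _ _ C0 fl.
by rewrite /Rintegral fineK//; exact: (integrable_fin_num measurableT fi).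
Qed.

Lemma laplace_deviation_pair n m (lambda : R) :
  (0 < n)%N -> (0 < m)%N -> 0 <= lambda ->
  (\int[iid_power mu n \x iid_power nu m]_xy (expR
      (lambda * (deviation F mu xy.1 - \int[iid_power mu n]_x deviation F mu x) +
       lambda * (deviation F nu xy.2 - \int[iid_power nu m]_x deviation F nu x)))%:E
   <= (expR (lambda ^+ 2 * (C ^+ 2 * v / n%:R + C ^+ 2 * v / m%:R)))%:E)%E.
Proof.
move=> n0 m0 l0.
have h1 := laplace_deviation sc F0 C0 lipF bF Lmu n0 l0.
have h2 := laplace_deviation sc F0 C0 lipF bF Lnu m0 l0.
set E1 := Rintegral _ _ _ in h1 *; set E2 := Rintegral _ _ _ in h2 *.
pose alpha (x : n.-tuple T) := expR (lambda * (deviation F mu x - E1)).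
pose beta (y : m.-tuple T) := expR (lambda * (deviation F nu y - E2)).
have mexp (P : probability T R) k b : laplace_bounded c P v ->
    measurable_fun setT (fun x : k.-tuple T =>
      (expR (lambda * (deviation F P x - b)))%:E).
  move=> LP; have mdev := @measurable_deviation _ _ _ _ _ _ _ sc F0 C0 lipF bF _ LP k.
  apply/measurable_EFinP; apply: (measurableT_comp (@measurable_expR R)).
  by apply: measurable_funM => //; exact: measurable_funB.
have malpha : measurable_fun setT (fun x : n.-tuple T => (alpha x)%:E).
  exact: mexp.
have mbeta : measurable_fun setT (fun y : m.-tuple T => (beta y)%:E).
  exact: mexp.
have alpha0 x : (0 <= (alpha x)%:E)%E by rewrite lee_fin expR_ge0.
have beta0 y : (0 <= (beta y)%:E)%E by rewrite lee_fin expR_ge0.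
pose f (xy : n.-tuple T * m.-tuple T) := ((alpha xy.1)%:E * (beta xy.2)%:E)%E.
have mf : measurable_fun setT f.
  apply: emeasurable_funM.
    exact: (measurableT_comp malpha measurable_fst).
  exact: (measurableT_comp mbeta measurable_snd).
under eq_integral do rewrite expRD EFinM.
rewrite (fubini_tonelli1 f)//; last by move=> xy; rewrite mule_ge0.
rewrite /fubini_F /f /=.
under eq_integral do rewrite ge0_integralZl//.
rewrite ge0_integralZr//; last exact: integral_ge0.
rewrite mulrDr expRD EFinM; apply: lee_pmul => //; exact: integral_ge0.
Qed.

(** The error of the distance is at most the sum Z of the two deviations. Chernoff's inequality
    controls the excess of Z over its mean and symmetrization bounds that mean; [lambda] stays free
    for later optimization. *)
Lemma deviation_bound n m (lambda eps delta : R) :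
  (0 < n)%N -> (0 < m)%N -> 0 <= lambda ->
  expR (lambda ^+ 2 * (C ^+ 2 * v / n%:R + C ^+ 2 * v / m%:R) - lambda * eps)
    <= delta ->
  ((1 - delta)%:E <= (iid_power mu n \x iid_power nu m)
    [set xy | `| F_distance F mu nu
                - F_distance F (empirical_measure R xy.1)
                               (empirical_measure R xy.2) |
              <= 2%:E * rademacher_complexity n F mu
                 + 2%:E * rademacher_complexity m F nu + eps%:E])%E.
Proof.
move=> n0 m0 l0 hdelta.
have mdev (P : probability T R) k : laplace_bounded c P v ->
    measurable_fun setT (fun x : k.-tuple T => deviation F P x).
  by move=> LP; exact: (measurable_deviation sc F0 C0 lipF bF LP).
have bmean (P : probability T R) : laplace_bounded c P v ->
    bounded_on F (fun f => \int[P]_y f y).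
  by move=> LP; exact: (bounded_mean F0 C0 lipF bF LP).
pose D := sup_abs F (fun f => \int[mu]_y f y - \int[nu]_y f y).
pose Dhat (xy : n.-tuple T * m.-tuple T) :=
  sup_abs F (fun f => emp xy.1 f - emp xy.2 f).
have DE : F_distance F mu nu = D%:E.
  by apply: F_distanceE;
    [move=> f; exact: integral_lip_class..|exact: bmean|exact: bmean].
have empE k (x : k.-tuple T) f : F f ->
    (\int[empirical_measure R x]_y (f y)%:E = (emp x f)%:E)%E.
  move=> Ff; apply: integral_empirical.
  exact: (measurable_lip_class sc C0 lipF Ff).
have DhatE xy : F_distance F (empirical_measure R xy.1)
    (empirical_measure R xy.2) = (Dhat xy)%:E.
  by apply: F_distanceE; [exact: empE..|exact: bounded_emp|exact: bounded_emp].
pose E1 := \int[iid_power mu n]_x deviation F mu x.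
pose E2 := \int[iid_power nu m]_y deviation F nu y.
pose Z (xy : n.-tuple T * m.-tuple T) :=
  deviation F mu xy.1 + deviation F nu xy.2.
have bDhat xy : bounded_on F (fun f => emp xy.1 f - emp xy.2 f).
  move: xy => [x y]; apply: bounded_onD; first exact: bounded_emp.
  by apply: bounded_onN; exact: bounded_emp.
have DZ xy : `|D - Dhat xy| <= Z xy.
  apply: sup_abs_dist => //.
    by apply: bounded_onD; [exact: bmean|apply: bounded_onN; exact: bmean].
  move=> f Ff.
  rewrite (_ : _ - _ = (\int[mu]_y f y - emp xy.1 f) -
    (\int[nu]_y f y - emp xy.2 f)); last by ring.
  apply: le_trans (ler_normB _ _) _; apply: lerD.
    exact: (le_sup_abs (bounded_deviation F0 C0 lipF bF Lmu xy.1) Ff).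
  exact: (le_sup_abs (bounded_deviation F0 C0 lipF bF Lnu xy.2) Ff).
(* Only measurability is at stake, so C/n and C/m are both enlarged to C to have one constant for
   the sum of the two costs. *)
have mDhat : measurable_fun setT Dhat.
  have sp := separable_prod (separable_tuple n sc) (separable_tuple m sc).
  apply: (lip_measurable sp C0) => x y; apply: sup_abs_dist => // f Ff.
  rewrite (_ : _ - _ = (emp x.1 f - emp y.1 f) - (emp x.2 f - emp y.2 f));
    last by ring.
  have Ck k (z w : k.-tuple T) : (0 < k)%N ->
      C / k%:R * tuple_cost c z w <= C * tuple_cost c z w.
    move=> k0; rewrite ler_wpM2r//; first by have [] := separable_tuple k sc.
    by rewrite ler_pdivrMr ?ltr0n// ler_peMr// ler1n.
  apply: le_trans (ler_normB _ _) _; rewrite mulrDr; apply: lerD.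
    exact: le_trans (emp_lip lipF Ff _ _) (Ck _ _ _ n0).
  exact: le_trans (emp_lip lipF Ff _ _) (Ck _ _ _ m0).
have mZ : measurable_fun setT Z.
  apply: measurable_funD.
    exact: (measurableT_comp (mdev _ n Lmu) measurable_fst).
  exact: (measurableT_comp (mdev _ m Lnu) measurable_snd).
pose P : probability (n.-tuple T * m.-tuple T)%type R :=
  (iid_power mu n \x iid_power nu m)%E.
pose bad := [set xy | E1 + E2 + eps < Z xy].
have mbad : measurable bad.
  have := emeasurable_fun_o_infty measurableT
    ((measurable_EFinP _ _).2 mZ) (E1 + E2 + eps)%:E.
  by rewrite setTI; under eq_set do rewrite lte_fin.
pose W (xy : n.-tuple T * m.-tuple T) :=
  lambda * (deviation F mu xy.1 - E1) + lambda * (deviation F nu xy.2 - E2).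
have WZ xy : W xy = lambda * (Z xy - (E1 + E2)) by rewrite /W /Z; ring.
have mW : measurable_fun setT (fun xy => (expR (W xy))%:E).
  apply/measurable_EFinP; apply: (measurableT_comp (@measurable_expR R)).
  rewrite (_ : W = fun xy => lambda * (Z xy - (E1 + E2))); last exact/funext.
  by apply: measurable_funM => //; exact: measurable_funB.
have W0 xy : (0 <= (expR (W xy))%:E)%E by rewrite lee_fin expR_ge0.
have k0 : 0 <= expR (- (lambda * eps)) by exact: expR_ge0.
(* Markov's inequality for the exponential: on [bad], W exceeds lambda * eps, so the integrand is at
   least 1 there. *)
have Pbad : (P bad <= delta%:E)%E.
  apply: (@le_trans _ _ (\int[P]_xy ((expR (- (lambda * eps)))%:E *
      (expR (W xy))%:E))%E).
    rewrite -[X in P X]setIT -integral_indic//; apply: ge0_le_integral => //.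
    - by apply/measurable_EFinP; exact: measurable_indic.
    - exact: measurable_funeM.
    - move=> xy _; rewrite -EFinM -expRD lee_fin indicE.
      have [/set_mem bxy|_] := boolP (xy \in bad); last exact: expR_ge0.
      rewrite -[leLHS]expR0 ler_expR WZ addrC -mulrBr mulr_ge0// -addrA -opprD.
      by rewrite subr_ge0 ltW.
  rewrite ge0_integralZl_EFin//.
  have := lee_wpmul2l (x := (expR (- (lambda * eps)))%:E) k0
    (laplace_deviation_pair n0 m0 l0).
  move=> /le_trans; apply; rewrite -EFinM -expRD lee_fin addrC.
  exact: hdelta.
have EE (Q : probability T R) k : (0 < k)%N -> laplace_bounded c Q v ->
    ((\int[iid_power Q k]_x deviation F Q x)%:E <=
     2%:E * rademacher_complexity k F Q)%E.
  move=> k1 LQ; have [di _] := laplace_iid (n := k) sc LQ (divr_ge0_natr C0 k)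
    (deviation_lip F0 C0 lipF bF LQ (n := k)).
  apply: le_trans (integral_deviation_rademacher sc F0 C0 lipF bF LQ k1).
  by rewrite /Rintegral fineK//; exact: (integrable_fin_num measurableT di).
pose B := (2%:E * rademacher_complexity n F mu +
  2%:E * rademacher_complexity m F nu + eps%:E)%E.
rewrite DE; set event := [set xy | _].
have mevent : measurable event.
  have mD : measurable_fun setT (fun xy => `|D - Dhat xy|%:E).
    apply/measurable_EFinP; apply: measurableT_comp => //.
    exact: measurable_funB.
  have := emeasurable_fun_infty_c measurableT mD B.
  rewrite setTI; congr measurable; apply/seteqP.
  by split=> xy /=; rewrite /event /= DhatE.
apply: (@le_trans _ _ (P (~` bad))).
  by rewrite probability_setC// EFinB leeB.
apply: le_measure; rewrite ?inE//; first exact: measurableC.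
move=> xy /negP; rewrite -leNgt => Zxy; rewrite /event /= DhatE /=.
apply: (@le_trans _ _ (E1 + E2 + eps)%:E).
  by rewrite lee_fin (le_trans (DZ xy)).
by rewrite !EFinD /B leeD2r// leeD// EE.
Qed.

End TwoSamples.

(** * Choice of the Chernoff parameter *)

Section SubGaussianSamples.
Context {R : realType}.

Lemma subgaussian_deviation_bound h n m (F : set (borelRn R h -> R))
    (C Gamma delta : R) (mu nu : probability (borelRn R h) R) :
  (0 < h)%N -> (0 < n)%N -> (0 < m)%N -> F !=set0 -> 0 < C -> 0 < Gamma ->
  (forall f, F f -> lip (@l2dist R h) C f) ->
  bounded_on F (fun f => f (0 : 'cV[R]_h)) ->
  class_uB Gamma mu -> class_uB Gamma nu -> 0 < delta < 1 ->
  ((1 - delta)%:E <= (iid_power mu n \x iid_power nu m)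
    [set xy | `| F_distance F mu nu
                - F_distance F (empirical_measure R xy.1)
                               (empirical_measure R xy.2) |
              <= 2%:E * rademacher_complexity n F mu
                 + 2%:E * rademacher_complexity m F nu
                 + (2 * Gamma * C * Num.sqrt (2 * h%:R * (n%:R^-1 + m%:R^-1)
                                              * ln (1 / delta)))%:E])%E.
Proof.
move=> h0 n0 m0 F0 C0 G0 lipF [B0 FB0] muG nuG /andP[d0 d1].
have bF x : bounded_on F (fun f => f x).
  exists (C * l2dist x 0 + B0) => f Ff; rewrite -[f x](subrK (f 0)).
  by rewrite (le_trans (ler_normD _ _))// lerD ?FB0//; exact: lipF.
set l := ln (1 / delta); set s := n%:R^-1 + m%:R^-1.
have l0 : 0 < l by rewrite ln_gt0// div1r invf_gt1.
have [nR mR hR] : [/\ 0 < n%:R :> R, 0 < m%:R :> R & 0 < h%:R :> R].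
  by rewrite !ltr0n.
have s0 : 0 < s by rewrite addr_gt0// invr_gt0.
set q := Num.sqrt _.
have q2 : q ^+ 2 = 2 * h%:R * s * l by rewrite sqr_sqrtr// !mulr_ge0// ltW.
(* With K = C^2 h Gamma^2 s and eps = 2 Gamma C q, this [lambda] is eps / (2 K), the minimizer of
   lambda^2 K - lambda eps; the minimum is -q^2 / (h s) = -2 l. *)
apply: (@deviation_bound _ _ _ _ F C _ (@separable_l2dist R h) F0 (ltW C0)
  lipF bF mu nu (laplace_l2dist muG) (laplace_l2dist nuG) n m
  (q / (C * h%:R * Gamma * s))) => //.
  by rewrite divr_ge0 ?sqrtr_ge0// ?mulr_ge0// ltW.
have [hn Cn Gn sn] : [/\ h%:R != 0 :> R, C != 0, Gamma != 0 & s != 0].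
  by rewrite !gt_eqF.
rewrite -mulrDr -/s (_ : _ - _ = - (2 * l)); last first.
  have exponentE (x y g t r : R) : x != 0 -> y != 0 -> g != 0 -> t != 0 ->
      (r / (x * y * g * t)) ^+ 2 * (x ^+ 2 * (y * g ^+ 2) * t) -
      r / (x * y * g * t) * (2 * g * x * r) = - (r ^+ 2 / (y * t)).
    by move=> x0 y0 g0 t0; field; do !(apply/andP; split).
  rewrite exponentE// q2 (_ : 2 * h%:R * s * l = h%:R * s * (2 * l)); last by ring.
  by rewrite mulrAC mulfV ?mul1r// mulf_neq0.
have dE : delta = expR (- l).
  by rewrite /l div1r lnV ?posrE// opprK lnK// posrE.
by rewrite [leRHS]dE ler_expR; lra.
Qed.

End SubGaussianSamples.

(** * Neural networks *)

Section Networks.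
Context {R : realType}.

(** Lagrange's identity: the double sum of the squares (a_i b_j - a_j b_i)^2 is twice the gap
    between the two sides. *)
Lemma cauchy_schwarz_sum n (a b : 'I_n -> R) :
  (\sum_(i < n) a i * b i) ^+ 2 <=
  (\sum_(i < n) a i ^+ 2) * (\sum_(i < n) b i ^+ 2).
Proof.
have h : 0 <= \sum_(i < n) \sum_(j < n) (a i * b j - a j * b i) ^+ 2.
  by apply: sumr_ge0 => i _; apply: sumr_ge0 => j _; exact: sqr_ge0.
have e : \sum_(i < n) \sum_(j < n) (a i * b j - a j * b i) ^+ 2 =
    \sum_(i < n) \sum_(j < n) (a i ^+ 2 * b j ^+ 2) +
    \sum_(i < n) \sum_(j < n) (b i ^+ 2 * a j ^+ 2) -
    2 * \sum_(i < n) \sum_(j < n) (a i * b i) * (a j * b j).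
  rewrite mulr_sumr -big_split -sumrB; apply: eq_bigr => i _ /=.
  rewrite mulr_sumr -big_split -sumrB; apply: eq_bigr => j _ /=.
  ring.
move: h; rewrite e -!big_distrlr /= => h.
by move: h; rewrite expr2; lra.
Qed.

Lemma l2norm_mulmx p r (W : 'M[R]_(p, r)) (u : 'cV[R]_r) :
  l2norm (W *m u) <= frobenius_norm W * l2norm u.
Proof.
rewrite /l2norm /frobenius_norm -sqrtrM; last first.
  by apply: sumr_ge0 => i _; apply: sumr_ge0 => j _; exact: sqr_ge0.
rewrite ler_wsqrtr// mulr_suml; apply: ler_sum => i _.
by rewrite mxE; exact: cauchy_schwarz_sum.
Qed.

Lemma dot_le_l2norm p (w u : 'cV[R]_p) :
  `|(w^T *m u) 0 0| <= l2norm w * l2norm u.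
Proof.
rewrite -sqrtrM; last by apply: sumr_ge0 => i _; exact: sqr_ge0.
rewrite -sqrtr_sqr ler_wsqrtr// mxE; under eq_bigr do rewrite mxE.
exact: cauchy_schwarz_sum.
Qed.

Lemma coord_le_l2norm p (u : 'cV[R]_p) i : `|u i 0| <= l2norm u.
Proof.
rewrite -sqrtr_sqr ler_wsqrtr// (bigD1 i)//= lerDl.
by apply: sumr_ge0 => j _; exact: sqr_ge0.
Qed.

Lemma l2norm_map_le p (s : R -> R) L (a b : 'cV[R]_p) :
  assumptionA L s -> l2norm (map_mx s a - map_mx s b) <= L * l2norm (a - b).
Proof.
move=> [_ _ _ L0 sL].
rewrite /l2norm -[L](ger0_norm (ltW L0)) -sqrtr_sqr -sqrtrM ?sqr_ge0//.
rewrite ler_wsqrtr// mulr_sumr; apply: ler_sum => i _.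
rewrite !mxE -exprMn -[leLHS]real_normK ?num_real// -[leRHS]real_normK ?num_real//.
by rewrite lerXn2r// normrM (ger0_norm (ltW L0)).
Qed.

Context (d : nat) (k : nat -> nat) (sigma : nat -> R -> R) (L M : nat -> R).
Context (d_gt0 : (0 < d)%N).
Context (sigmaA : forall i, (1 <= i < d)%N -> assumptionA (L i) (sigma i)).
Context (M_gt0 : forall i, (1 <= i <= d)%N -> 0 < M i).

(** The Lipschitz constant of the i-th hidden layer; both products are empty at i = 0, the input
    itself. *)
Let C i := (\prod_(1 <= j < i.+1) M j) * (\prod_(1 <= j < i.+1) L j).

Lemma layer_const_ge0 i : (i < d)%N -> 0 <= C i.
Proof.
move=> id; rewrite mulr_ge0//.
  rewrite big_nat_cond; apply: prodr_ge0 => j /andP[/andP[j1 ji] _].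
  by rewrite ltW// M_gt0// j1 ltnW// (leq_trans ji).
rewrite big_nat_cond; apply: prodr_ge0 => j /andP[/andP[j1 ji] _].
have jd : (1 <= j < d)%N by rewrite j1 (leq_trans ji).
by have [_ _ _ /ltW] := sigmaA jd.
Qed.

Lemma layer_constS i : C i.+1 = C i * (M i.+1 * L i.+1).
Proof. by rewrite /C big_nat_recr//= [X in _ * X]big_nat_recr//= mulrACA. Qed.

Lemma hidden_layer_lip_F (theta : parameters k d) (x y : 'cV[R]_(k 1%N)) i :
  (forall i, (1 <= i < d)%N -> frobenius_norm (weights theta i) <= M i) ->
  (i < d)%N ->
  l2norm (hidden_layer sigma (weights theta) x i -
          hidden_layer sigma (weights theta) y i) <= C i * l2norm (x - y).
Proof.
move=> WM; elim: i => [|i IHi] id.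
  by rewrite /C !big_geq// !mul1r.
have id1 : (1 <= i.+1 < d)%N by [].
rewrite /=; apply: le_trans (l2norm_map_le _ _ (sigmaA id1)) _.
rewrite -mulmxBr; have [_ _ _ L0 _] := sigmaA id1.
apply: (@le_trans _ _ (L i.+1 * (M i.+1 * (C i * l2norm (x - y))))).
  rewrite ler_pM2l//; apply: le_trans (l2norm_mulmx _ _) _.
  by apply: ler_pM; rewrite ?sqrtr_ge0 ?WM ?IHi// ltnW.
by rewrite layer_constS le_eqVlt; apply/orP; left; apply/eqP; ring.
Qed.

(** Each coordinate is followed separately because the l1 norm of a row is dual to the max norm. The
    Euclidean norm enters only at the input, where it dominates every coordinate. *)
Lemma hidden_layer_lip_1inf (theta : parameters k d) (x y : 'cV[R]_(k 1%N)) i j :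
  (forall i, (1 <= i < d)%N -> max_row_l1norm (weights theta i) <= M i) ->
  (i < d)%N ->
  `|(hidden_layer sigma (weights theta) x i -
     hidden_layer sigma (weights theta) y i) j 0| <= C i * l2norm (x - y).
Proof.
move=> WM; elim: i j => [|i IHi] j id.
  by rewrite /C !big_geq// !mul1r; exact: coord_le_l2norm.
have id1 : (1 <= i.+1 < d)%N by [].
have [_ _ _ L0 sL] := sigmaA id1.
have B0 : 0 <= C i * l2norm (x - y).
  by rewrite mulr_ge0 ?sqrtr_ge0// layer_const_ge0// ltnW.
rewrite [hidden_layer _ _ x _]/= [hidden_layer _ _ y _]/= mxE [(map_mx _ _) _ _]mxE.
rewrite [X in `|_ + X|]mxE [(map_mx _ _) _ _]mxE.
apply: le_trans (sL _ _) _.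
apply: (@le_trans _ _ (L i.+1 * (M i.+1 * (C i * l2norm (x - y))))); last first.
  by rewrite layer_constS le_eqVlt; apply/orP; left; apply/eqP; ring.
rewrite ler_pM2l//.
set hx := hidden_layer _ _ x i in IHi *; set hy := hidden_layer _ _ y i in IHi *.
rewrite !mxE -sumrB.
apply: le_trans (ler_norm_sum _ _ _) _.
apply: (@le_trans _ _ (\sum_b `|weights theta i.+1 j b| * (C i * l2norm (x - y)))).
  apply: ler_sum => b _; rewrite -mulrBr normrM ler_wpM2l//.
  by have := IHi b (ltnW id); rewrite !mxE.
rewrite -mulr_suml ler_wpM2r//; apply: le_trans (WM _ id1).
exact: (le_bigmax _ (fun j => \sum_b `|weights theta i.+1 j b|) j).
Qed.

Definition network_lip : R :=
  (\prod_(1 <= i < d.+1) M i) * (\prod_(1 <= i < d) L i).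

Lemma network_lipE : network_lip = M d * C d.-1.
Proof.
by rewrite /network_lip /C prednK// big_nat_recr//= mulrAC mulrC.
Qed.

Lemma network_lip_gt0 : 0 < network_lip.
Proof.
rewrite mulr_gt0//.
  rewrite big_nat_cond; apply: prodr_gt0 => j /andP[/andP[j1 jd] _].
  by rewrite M_gt0// j1.
rewrite big_nat_cond; apply: prodr_gt0 => j /andP[jd _].
by have [] := sigmaA jd.
Qed.

Lemma network_lip_F (theta : parameters k d) :
  parameters_F M theta -> lip (@l2dist R (k 1%N)) network_lip (network sigma theta).
Proof.
move=> [WM wM] x y; rewrite network_lipE /network.
have id : (d.-1 < d)%N by rewrite prednK.
rewrite -mulrA (_ : _ - _ = ((output_weights theta)^T *m
  (hidden_layer sigma (weights theta) x d.-1 -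
   hidden_layer sigma (weights theta) y d.-1)) 0 0); last by rewrite mulmxBr !mxE.
apply: le_trans (dot_le_l2norm _ _) _.
by apply: ler_pM => //; rewrite ?sqrtr_ge0//; exact: hidden_layer_lip_F.
Qed.

Lemma network_lip_1inf (theta : parameters k d) :
  parameters_1inf M theta ->
  lip (@l2dist R (k 1%N)) network_lip (network sigma theta).
Proof.
move=> [WM wM] x y; rewrite network_lipE /network.
have id : (d.-1 < d)%N by rewrite prednK.
rewrite -mulrA (_ : _ - _ = ((output_weights theta)^T *m
  (hidden_layer sigma (weights theta) x d.-1 -
   hidden_layer sigma (weights theta) y d.-1)) 0 0); last by rewrite mulmxBr !mxE.
have B0 : 0 <= C d.-1 * l2norm (x - y).
  by rewrite mulr_ge0 ?sqrtr_ge0// layer_const_ge0.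
rewrite mxE; apply: le_trans (ler_norm_sum _ _ _) _.
apply: le_trans (ler_wpM2r B0 wM); rewrite mulr_suml; apply: ler_sum => b _.
rewrite mxE normrM ler_wpM2l//; exact: hidden_layer_lip_1inf.
Qed.

(** Entrywise bounds suffice for boundedness at a fixed point, and both norm constraints imply them.
    The bound is built layer by layer; as an activation may be nonzero at 0, its value there is
    added each time. *)
Lemma network_bounded (Theta : set (parameters k d)) (x : 'cV[R]_(k 1%N)) :
  (forall theta, Theta theta ->
    (forall i, (1 <= i < d)%N -> forall a b, `|weights theta i a b| <= M i) /\
    forall a, `|output_weights theta a 0| <= M d) ->
  bounded_on (network_class sigma Theta) (fun f => f x).
Proof.
move=> ThetaM.
have hidden i : (i < d)%N -> exists B, forall theta a, Theta theta ->
    `|hidden_layer sigma (weights theta) x i a 0| <= B.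
  elim: i => [_|i IHi id].
    exists (l2norm x) => theta a _; exact: coord_le_l2norm.
  have id1 : (1 <= i.+1 < d)%N by [].
  have [B hB] := IHi (ltnW id); have [_ _ _ L0 sL] := sigmaA id1.
  exists (L i.+1 * (\sum_(b < k i.+1) M i.+1 * B) + `|sigma i.+1 0|) => theta a Th.
  rewrite /= mxE.
  set t := (_ *m _) a 0; rewrite -[sigma _ t](subrK (sigma i.+1 0)).
  rewrite (le_trans (ler_normD _ _))// lerD// (le_trans (sL _ _))//.
  rewrite ler_pM2l// subr0 /t mxE (le_trans (ler_norm_sum _ _ _))//.
  apply: ler_sum => b _; rewrite normrM ler_pM// ?hB//.
  by have [WM _] := ThetaM _ Th; exact: WM.
have [B hB] := hidden d.-1 (ltac:(by rewrite prednK)).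
exists (\sum_(b < k d.-1.+1) M d * B) => _ [theta Th <-].
rewrite /network mxE (le_trans (ler_norm_sum _ _ _))//.
apply: ler_sum => b _; rewrite mxE normrM ler_pM// ?hB//.
by have [_ wM] := ThetaM _ Th; exact: wM.
Qed.

Lemma network_bounded_F x :
  bounded_on (network_class sigma (@parameters_F R k d M)) (fun f => f x).
Proof.
apply: network_bounded => theta [WM wM]; split.
  move=> i /WM WMi a b; apply: le_trans WMi.
  rewrite -sqrtr_sqr ler_wsqrtr// (bigD1 a)//= (bigD1 b)//= -addrA lerDl addr_ge0//.
    by apply: sumr_ge0 => j _; exact: sqr_ge0.
  by apply: sumr_ge0 => j _; apply: sumr_ge0 => l _; exact: sqr_ge0.
by move=> a; apply: le_trans wM; exact: coord_le_l2norm.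
Qed.

Lemma network_bounded_1inf x :
  bounded_on (network_class sigma (@parameters_1inf R k d M)) (fun f => f x).
Proof.
apply: network_bounded => theta [WM wM]; split.
  move=> i /WM WMi a b; apply: le_trans WMi.
  apply: le_trans (le_bigmax _ (fun a => \sum_b `|weights theta i a b|) a).
  by rewrite (bigD1 b)//= lerDl sumr_ge0.
by move=> a; apply: le_trans wM; rewrite /l1norm (bigD1 a)//= lerDl sumr_ge0.
Qed.

Lemma network_class_F_neq0 : network_class sigma (@parameters_F R k d M) !=set0.
Proof.
pose theta0 : @parameters R k d := MkParameters (fun=> 0) 0.
exists (network sigma theta0), theta0 => //; split=> [i /andP[i1 id]|].
  have Mi : 0 <= M i by rewrite ltW// M_gt0// i1 ltnW.
  rewrite /frobenius_norm big1 ?sqrtr0// => a _.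
  by apply: big1 => b _; rewrite mxE expr0n.
have Md : 0 <= M d by rewrite ltW// M_gt0// d_gt0 leqnn.
by rewrite /l2norm big1 ?sqrtr0// => a _; rewrite mxE expr0n.
Qed.

Lemma network_class_1inf_neq0 :
  network_class sigma (@parameters_1inf R k d M) !=set0.
Proof.
pose theta0 : @parameters R k d := MkParameters (fun=> 0) 0.
exists (network sigma theta0), theta0 => //; split=> [i /andP[i1 id]|].
  have Mi : 0 <= M i by rewrite ltW// M_gt0// i1 ltnW.
  apply: bigmax_le => // a _; rewrite big1// => b _.
  by rewrite mxE normr0.
have Md : 0 <= M d by rewrite ltW// M_gt0// d_gt0 leqnn.
by rewrite /l1norm big1// => a _; rewrite mxE normr0.
Qed.

End Networks.

Theorem theorem6 (R : realType) (d : nat) (k : nat -> nat) (n m : nat)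
    (sigma : nat -> R -> R) (L M_F M_1inf : nat -> R) (Gamma delta : R)
    (mu nu : probability (borelRn R (k 1%N)) R)
    (d_ge2 : (2 <= d)%N)
    (k_ge1 : forall i, (1 <= i <= d)%N -> (1 <= k i)%N)
    (n_ge1 : (1 <= n)%N) (m_ge1 : (1 <= m)%N)
    (M_F_gt0 : forall i, (1 <= i <= d)%N -> 0 < M_F i)
    (M_1inf_gt0 : forall i, (1 <= i <= d)%N -> 0 < M_1inf i)
    (sigmaA : forall i, (1 <= i < d)%N -> assumptionA (L i) (sigma i))
    (sigmaB : forall i, (1 <= i < d)%N -> assumptionB (sigma i))
    (Gamma_gt0 : 0 < Gamma)
    (mu_uB : class_uB Gamma mu) (nu_uB : class_uB Gamma nu)
    (delta_01 : 0 < delta < 1)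
    (hnm : 4 * Num.sqrt (ln (1 / delta)) <=
      Num.sqrt (6 * (k 1%N)%:R) * (minn n m)%:R
        * Num.sqrt (m%:R^-1 + n%:R^-1)) :
  (let F := network_class sigma (@parameters_F R k d M_F) in
   (1 - delta)%:E <=
   (iid_power mu n \x iid_power nu m)
     [set xy | `| F_distance F mu nu
                 - F_distance F (empirical_measure R xy.1)
                                (empirical_measure R xy.2) |
               <= 2%:E * rademacher_complexity n F mu
                  + 2%:E * rademacher_complexity m F nu
                  + (2 * Gamma * (\prod_(1 <= i < d.+1) M_F i)
                       * (\prod_(1 <= i < d) L i)
                       * Num.sqrt (2 * (k 1%N)%:R * (n%:R^-1 + m%:R^-1)
                                     * ln (1 / delta)))%:E])%E
  /\
  (let F := network_class sigma (@parameters_1inf R k d M_1inf) in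
   (1 - delta)%:E <=
   (iid_power mu n \x iid_power nu m)
     [set xy | `| F_distance F mu nu
                 - F_distance F (empirical_measure R xy.1)
                                (empirical_measure R xy.2) |
               <= 2%:E * rademacher_complexity n F mu
                  + 2%:E * rademacher_complexity m F nu
                  + (2 * Gamma * (\prod_(1 <= i < d.+1) M_1inf i)
                       * (\prod_(1 <= i < d) L i)
                       * Num.sqrt (2 * (k 1%N)%:R * (n%:R^-1 + m%:R^-1)
                                     * ln (1 / delta)))%:E])%E.
Proof.
have d_gt0 : (0 < d)%N := ltnW d_ge2.
have k1 : (0 < k 1%N)%N by rewrite k_ge1// d_gt0.
split=> F.
  have := subgaussian_deviation_bound k1 n_ge1 m_ge1
    (network_class_F_neq0 k sigma d_gt0 M_F_gt0)
    (network_lip_gt0 sigmaA M_F_gt0) Gamma_gt0 _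
    (network_bounded_F M_F d_gt0 sigmaA _) mu_uB nu_uB delta_01.
  rewrite /network_lip mulrA; apply.
  by move=> _ [theta Th <-]; exact: (network_lip_F d_gt0 sigmaA Th).
have := subgaussian_deviation_bound k1 n_ge1 m_ge1
  (network_class_1inf_neq0 k sigma d_gt0 M_1inf_gt0)
  (network_lip_gt0 sigmaA M_1inf_gt0) Gamma_gt0 _
  (network_bounded_1inf M_1inf d_gt0 sigmaA _) mu_uB nu_uB delta_01.
rewrite /network_lip mulrA; apply.
by move=> _ [theta Th <-]; exact: (network_lip_1inf d_gt0 sigmaA M_1inf_gt0 Th).
Qed.
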